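(* Let $(b,c)$ be a locally finite and connected graph over a countable set $X$, with a cocompact action of a nilpotent group $G$ such that $H_{b,c}$ is $G$-invariant, and fix $x_0\in X$. For $\lambda\in\mathbb{R}$ let $\mathcal{M}_\lambda$ be the set of multiplicative functions in $\mathcal{K}_\lambda$, and for $I\subseteq\mathbb{R}$ let $\mathcal{M}_I=\bigcup_{\lambda\in I}\mathcal{M}_\lambda$, all with the topology of pointwise convergence. Then there exist $\lambda_0\in\mathbb{R}$ and $d\in\mathbb{N}_0$ such that: (a) $\mathcal{M}_\lambda=\emptyset$ for $\lambda>\lambda_0$; (b) $\mathcal{M}_{\lambda_0}$ consists of exactly one point; (c) for $\lambda<\lambda_0$, $\mathcal{M}_\lambda$ is homeomorphic to a $(d-1)$-sphere (empty if $d=0$); (d) for every $\lambda\in[-\infty,\lambda_0)$, $\mathcal{M}_{(\lambda,\lambda_0]}$ is homeomorphic to an open $d$-ball.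
   Context: $X$ is countable; a graph is $(b,c)$ with $b:X\times X\to[0,\infty)$, $c:X\to\mathbb{R}$, $\sum_y b(x,y)<\infty$ for all $x$ ($b$ need not be symmetric); locally finite: each $x$ has finitely many $y$ with $b(x,y)>0$; connected: any two points are joined by a finite sequence $y_1,\dots,y_n$ with $b(y_i,y_{i+1})>0$. $H_{b,c}f(x)=\sum_y b(x,y)(f(x)-f(y))+c(x)f(x)$ on $\mathrm{Dom}(H)=\{f:\sum_y b(x,y)|f(y)|<\infty\ \forall x\}$. For $\lambda\in\mathbb{R}$, $f$ is $\lambda$-harmonic if $f\in\mathrm{Dom}(H)$ and $(H_{b,c}-\lambda)f=0$, i.e. harmonic for the graph $(b,c-\lambda)$. $\mathcal{K}_\lambda$ is the closure in $C(X)$ (pointwise convergence) of $\{f\ge0,\ f\not\equiv0,\ \lambda\text{-harmonic},\ f(x_0)=1\}$. For $G$ acting on $X$, $T_gf(x)=f(g^{-1}x)$; cocompact: $GV=X$ for some finite $V$; $H$ is $G$-invariant if $T_g(\mathrm{Dom}H)\subseteq\mathrm{Dom}H$ and $HT_g=T_gH$ for all $g$; $f$ is multiplicative if $T_gf=\gamma(g^{-1})f$ for all $g\in G$ for some homomorphism $\gamma:G\to(0,\infty)$. *)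

(* Defs.v *)
From HB Require Import structures.
From mathcomp Require Import all_boot all_order all_algebra.
From mathcomp Require Import all_classical all_reals all_analysis.
Set Implicit Arguments. Unset Strict Implicit. Unset Printing Implicit Defensive.
Import Order.TTheory GRing.Theory Num.Theory.
Import numFieldNormedType.Exports.
Local Open Scope classical_set_scope.
Local Open Scope ring_scope.

Section Nilpotent.
Variable G : groupType.
Definition gen_subgroup (S : set G) : set G :=
  fun x => forall P : set G,
    P 1%g -> (forall a b, P a -> P b -> P (a * b)%g) -> (forall a, P a -> P (a^-1)%g) ->
    S `<=` P -> P x.
Fixpoint lower_central (n : nat) : set G :=
  match n with
  | 0%N => setT
  | k.+1 => gen_subgroup [set [~ a, g]%g | a in lower_central k & g in setT]
  end.
Definition nilpotent_group : Prop := exists n : nat, lower_central n = [set 1%g].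
End Nilpotent.

Definition is_action (G : groupType) (X : Type) (act : G -> X -> X) : Prop :=
  (forall x, act 1%g x = x) /\ (forall g h x, act (g * h)%g x = act g (act h x)).

Definition cocompact (G : groupType) (X : Type) (act : G -> X -> X) : Prop :=
  exists V : set X, finite_set V /\ forall x, exists g v, V v /\ x = act g v.

Definition Tg (G : groupType) (X : Type) (R : Type) (act : G -> X -> X)
  (g : G) (f : X -> R) : X -> R := fun x => f (act (g^-1)%g x).

Section Graphs.
Variables (R : realType) (X : countType).

Definition locally_finite (b : X -> X -> R) : Prop :=
  forall x, finite_set [set y | b x y > 0].

Definition connected_graph (b : X -> X -> R) : Prop :=
  forall x y, exists s : seq X, path (fun u v => 0 < b u v) x s /\ last x s = y.

(* The operator H_{b,c}; for a locally finite graph the sum is a finite sum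
   over the neighbours, and Dom(H) is the set of all functions. *)
Definition Hop (b : X -> X -> R) (c : X -> R) (f : X -> R) : X -> R :=
  fun x => (\sum_(y \in [set y | b x y > 0]) b x y * (f x - f y)) + c x * f x.

Definition G_invariant (G : groupType) (act : G -> X -> X)
  (b : X -> X -> R) (c : X -> R) : Prop :=
  forall g (f : X -> R) x, Hop b c (Tg act g f) x = Tg act g (Hop b c f) x.

Definition harmonic_at (b : X -> X -> R) (c : X -> R) (lam : R) (f : X -> R) : Prop :=
  forall x, Hop b c f x - lam * f x = 0.

Definition pos_harm_normalized (b : X -> X -> R) (c : X -> R) (x0 : X) (lam : R)
  : set {ptws X -> R} :=
  [set f | (forall x, 0 <= f x) /\ (exists x, f x != 0) /\ harmonic_at b c lam f /\ f x0 = 1].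

Definition Kset (b : X -> X -> R) (c : X -> R) (x0 : X) (lam : R) : set {ptws X -> R} :=
  closure (pos_harm_normalized b c x0 lam).

Definition multiplicative_fun (G : groupType) (act : G -> X -> X) (f : X -> R) : Prop :=
  exists gam : G -> R,
    (forall g h, gam (g * h)%g = gam g * gam h) /\ (forall g, 0 < gam g) /\
    (forall g, Tg act g f = (fun x => gam (g^-1)%g * f x)).

Definition Mset (G : groupType) (act : G -> X -> X) (b : X -> X -> R) (c : X -> R)
  (x0 : X) (lam : R) : set {ptws X -> R} :=
  [set f | Kset b c x0 lam f /\ multiplicative_fun act f].

Definition MsetI (G : groupType) (act : G -> X -> X) (b : X -> X -> R) (c : X -> R)
  (x0 : X) (I : set R) : set {ptws X -> R} :=
  \bigcup_(lam in I) Mset act b c x0 lam.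
End Graphs.

Definition homeomorphic (T U : topologicalType) (A : set T) (B : set U) : Prop :=
  exists (f : T -> U) (g : U -> T),
    [/\ (forall a, A a -> B (f a)), (forall b, B b -> A (g b)),
        (forall a, A a -> g (f a) = a) /\ (forall b, B b -> f (g b) = b),
        {within A, continuous f} & {within B, continuous g}].

Definition sphere (R : realType) (d : nat) : set 'rV[R]_d :=
  [set v | \sum_(i < d) v ord0 i ^+ 2 = 1].
Definition open_ball (R : realType) (d : nat) : set 'rV[R]_d :=
  [set v | \sum_(i < d) v ord0 i ^+ 2 < 1].

(* Main.v *)
Require Import Defs.
From HB Require Import structures.
From mathcomp Require Import all_boot all_order all_algebra.
From mathcomp Require Import all_classical all_reals all_analysis.
From mathcomp Require Import ring lra.
Import Order.TTheory GRing.Theory Num.Theory.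
Import numFieldNormedType.Exports.
Local Open Scope classical_set_scope.
Local Open Scope ring_scope.
Set Implicit Arguments.
Unset Strict Implicit.

(* A positive multiplicative eigenfunction [f] is determined by its character
   [g |-> ln (f (g x0))]. The characters that occur are exactly the displacements
   of functions [l : X -> R] with [l (g x) - l x] independent of [x]; by
   cocompactness and connectedness they form a space of finite dimension [d].
   Each of them is the character of a unique eigenfunction, obtained by a
   Perron-Frobenius argument: maximize [mu] subject to [H f >= mu f] over the
   multiplicative [f > 0] with that character, a compact family by Harnack's
   inequality. The eigenvalue is a strictly concave function on R^d, because the
   geometric mean of two eigenfunctions is a supersolution, and its superlevel
   sets are compact. So it has a unique maximum point, its level sets below the
   maximum are spheres around that point, and its open superlevel sets are balls. *)

(** * Topology and concave functions *)

(** If a neighbourhood [O] of [x] is not in [F], the trace of [F] on its complement is proper; by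
    compactness it clusters in [K], necessarily at [x], which [O] keeps away from the complement. *)
Lemma compact_cvg_unique_cluster (T : topologicalType) (F : set_system T)
    (FF : ProperFilter F) (K : set T) (x : T) :
  compact K -> F K -> (forall y, K y -> cluster F y -> y = x) -> F --> x.
Proof.
move=> cK FK uniq O Ox; apply: contrapT => nFO.
have PF : ProperFilter (within (~` O) F).
  apply: Build_ProperFilter_ex => P FP; apply: contrapT => nP; apply: nFO.
  apply: (@filterS _ F _ _ _ _ (FP : F [set x | (~` O) x -> P x])) => z zP; apply: contrapT => Oz.
  by apply: nP; exists z; exact: zP.
have [|y [Ky cly]] := cK _ PF; first by apply: filterS FK => z Kz _.
have yx : y = x.
  by apply: uniq => // C D FC yD; apply: cly => //; exact: filterS FC.
have [||z [nOz Oz]] := cly (~` O) O; last exact: nOz.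
  exact: (@nearW _ F).
by rewrite yx.
Qed.

(** Continuity of the inverse at [b]: its values near [b] stay in the compact [K], and any cluster
    point is mapped to [b] because [U] is Hausdorff. [K] may leave [A], as long as its points over
    [b] belong to [A]. *)
Lemma homeomorphic_locally_compact (T U : topologicalType) (A : set T)
    (B : set U) (h : T -> U) (t0 : T) :
  hausdorff_space U ->
  (forall a, A a -> B (h a)) ->
  (forall b, B b -> exists2 a, A a & h a = b) ->
  (forall a a', A a -> A a' -> h a = h a' -> a = a') ->
  (forall b, B b -> exists K N, [/\ nbhs b N, compact K,
     A `&` h @^-1` N `<=` K, forall a, K a -> {for a, continuous h} &
     forall a, K a -> h a = b -> A a]) ->
  homeomorphic A B.
Proof.
move=> hU hAB hsurj hinj hK.
(* [t0] is the default where no preimage in [A] exists. *)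
pose g b := xget t0 [set a | A a /\ h a = b].
have gP b : B b -> A (g b) /\ h (g b) = b.
  by move=> Bb; have [a Aa ab] := hsurj b Bb; apply: (xgetPex t0 (P := [set a | A a /\ h a = b])); exists a.
exists h, g; split => //.
- by move=> b /gP[].
- split=> [a Aa|b /gP[]//].
  by have [Aga hga] := gP _ (hAB _ Aa); apply: hinj.
- apply/subspace_continuousP => a Aa.
  have [K [N [bN _ sK cK _]]] := hK _ (hAB _ Aa).
  apply: cvg_within_filter; apply: cK; apply: sK; split => //=.
  exact: nbhs_singleton.
- apply/subspace_continuousP => b Bb.
  have [K [N [bN cK sK hc KA]]] := hK _ Bb.
  have PFw : ProperFilter (within B (nbhs b)).
    apply: Build_ProperFilter_ex => P bP.
    by exists b; apply: (nbhs_singleton bP).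
  have FN : (g @ within B (nbhs b)) K.
    apply: filterS (bN : nbhs b N) => c Nc Bc; have [Agc hgc] := gP _ Bc.
    by apply: sK; split => //=; rewrite hgc.
  apply: (@compact_cvg_unique_cluster _ _ _ K) => // y Ky cly.
  have [Ag hg] := gP _ Bb.
  suff hy : h y = b by apply: hinj => //; [exact: KA|rewrite hg].
  apply/esym/hU => C D bC hyD.
  have [z [Cz Dz]] : exists z, C (h z) /\ D (h z).
    have := cly (h @^-1` C) (h @^-1` D); case.
    + apply: filterS bC => c Cc Bc /=.
      by have [_ ->] := gP _ Bc.
    + exact: hc hyD.
    + by move=> z [? ?]; exists z.
  by exists (h z).
Qed.

Lemma continuous_rV (R : realType) (T : topologicalType) n (h : T -> 'rV[R]_n)
    (a : T) :
  (forall i, {for a, continuous (fun t => h t ord0 i)}) ->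
  {for a, continuous h}.
Proof.
move=> hc B [P hP sPB].
have : \forall t \near a, forall i, P ord0 i (h t ord0 i).
  by apply: filter_forall => i; exact: hc (hP ord0 i).
by apply: filterS => t tP; apply: sPB => i j; rewrite ord1.
Qed.

Lemma rV_hausdorff (R : realType) n : hausdorff_space 'rV[R]_n.
Proof.
move=> p q pq; apply/rowP => i; apply: (@Rhausdorff R) => C D pC qD.
have [||z [Cz Dz]] := pq ((fun M : 'rV[R]_n => M ord0 i) @^-1` C)
   ((fun M : 'rV[R]_n => M ord0 i) @^-1` D).
- by apply: coord_continuous; assumption.
- by apply: coord_continuous; assumption.
- by exists (z ord0 i).
Qed.

Lemma closed_le_fun (R : realType) (T : topologicalType) (p q : T -> R) :
  continuous p -> continuous q -> closed [set t | p t <= q t].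
Proof.
move=> cp cq.
rewrite (_ : [set t | _] = (fun t => q t - p t) @^-1` [set x | 0 <= x]).
  apply: preimage_closed; last exact: closed_ge.
  by move=> t _; apply: cvgB; [exact: cq|exact: cp].
by apply/seteqP; split=> t /=; rewrite subr_ge0.
Qed.

Lemma closed_eq_fun (R : realType) (T : topologicalType) (p q : T -> R) :
  continuous p -> continuous q -> closed [set t | p t = q t].
Proof.
move=> cp cq; rewrite (_ : [set t | _] =
    [set t | p t <= q t] `&` [set t | q t <= p t]).
  by apply: closedI; apply: closed_le_fun.
apply/seteqP; split=> t /=; first by move=> ->.
by case=> pq qp; apply/eqP; rewrite eq_le pq.
Qed.

Lemma closed_all (T : topologicalType) (I : Type) (P : I -> T -> Prop) :
  (forall i, closed [set t | P i t]) -> closed [set t | forall i, P i t].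
Proof.
move=> cP; rewrite (_ : [set t | _] = \bigcap_i [set t | P i t]).
  by apply: closed_bigI => i _; exact: cP.
by apply/seteqP; split=> t /= Pt i; [move=> _; exact: Pt|exact: (Pt i)].
Qed.

Lemma continuous_big_sum (R : realType) (T : topologicalType) (I : Type)
    (s : seq I) (F : I -> T -> R) (a : T) :
  (forall i, {for a, continuous (F i)}) ->
  {for a, continuous (fun t => \sum_(i <- s) F i t)}.
Proof.
move=> cF; apply: cvg_big => [|i _]; last exact: cF.
exact: add_continuous.
Qed.

(** The root is the supremum of the points of [0, T] where [phi] is positive; concavity on the whole
    line takes the place of continuity. *)
Lemma concave_root (R : realType) (phi : R -> R) (T : R) :
  (forall s t p, 0 <= p <= 1 ->
     p * phi s + (1 - p) * phi t <= phi (p * s + (1 - p) * t)) ->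
  0 < phi 0 -> 0 <= T -> phi T <= 0 -> exists2 t, 0 < t & phi t = 0.
Proof.
move=> cc phi0 T0 phiT.
pose E := [set t | [/\ 0 <= t, t <= T & 0 < phi t]].
have supE : has_sup E by split; [exists 0|exists T => t []].
have ubE := sup_upper_bound supE.
set t := sup E.
have t0 : 0 <= t by apply: ubE; split.
have tT : t <= T by apply: ge_sup; [exists 0; split|move=> s []].
have phit : phi t = 0.
  apply/eqP; rewrite eq_le; apply/andP; split.
  - rewrite leNgt; apply/negP => pt.
    have ltT : t < T.
      by rewrite lt_neqAle tT andbT; apply: contraTN pt => /eqP ->; rewrite -leNgt.
    pose d := phi t - phi T.
    have d0 : 0 < d by rewrite /d; lra.
    (* Moving from [t] toward [T] with weight [p] costs at most half of [phi t], so [phi] is still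
       positive beyond the supremum. *)
    pose p := phi t / (2 * d).
    have p0 : 0 < p by rewrite /p divr_gt0// mulr_gt0.
    have pd : p * d = phi t / 2 by rewrite /p; field; rewrite gt_eqF.
    have p1 : p <= 1.
      by rewrite /p ler_pdivrMr ?mulr_gt0// mul1r /d; lra.
    have /(_ T t p) := cc; rewrite (ltW p0) p1 => /(_ isT) cp.
    have : E (p * T + (1 - p) * t).
      split; first nra.
        nra.
      by apply: lt_le_trans cp; move: pd; rewrite /d; lra.
    by move/ubE; rewrite -/t; nra.
  - (* Concavity on [s, T + 1] for [s < t] excludes [phi t < 0], also if [t = T]. *)
    rewrite leNgt; apply/negP => pt.
    pose m := `|phi (T + 1)| + 1.
    have m0 : 0 < m by rewrite /m ltr_pwDr.
    have em : 0 < - phi t / m by rewrite divr_gt0// oppr_gt0.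
    (* With [t] written as a mean of [s] and [T + 1], the weight of [T + 1] is at most [t - s].
       Hence [phi t >= - (t - s) * m], and [s] is so close to [t] that this bound exceeds
       [phi t]. *)
    have [s [s0 sT ps]] := sup_adherent em supE; rewrite -/t => ts.
    have st : s <= t by apply: ubE.
    have w0 : 0 < T + 1 - s by lra.
    pose p := (T + 1 - t) / (T + 1 - s).
    have pE : p * (T + 1 - s) = T + 1 - t by rewrite /p divfK// gt_eqF.
    have p01 : 0 <= p <= 1.
      rewrite /p divr_ge0 ?ler_pdivrMr//; lra.
    have := cc s (T + 1) p p01.
    have -> : p * s + (1 - p) * (T + 1) = t by lra.
    have /andP[p0 p1] := p01.
    have : (t - s) * m < - phi t by rewrite -ltr_pdivlMr//; lra.
    have : 1 - p <= t - s.
      have : (1 - p) * (T + 1 - s) = t - s by lra.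
      nra.
    have : - m <= phi (T + 1).
      by rewrite /m; have := ler_norm (- phi (T + 1)); rewrite normrN; lra.
    by nra.
exists t => //; rewrite lt_neqAle t0 andbT; apply: contraTneq phi0 => e.
by rewrite [X in phi X]e phit ltxx.
Qed.

(** * Finite separating families and dual bases *)

Definition separating (R : realType) (T : Type) (A : set (T -> R)) (d : nat)
    (t : 'I_d -> T) :=
  forall a, A a -> (forall i, a (t i) = 0) -> forall x, a x = 0.

(* In a separating family of minimal size no member is redundant, and this
   provides the dual basis directly. *)
Lemma exists_dual_basis (R : realType) (T : eqType) (A : set (T -> R))
    (S : seq T) :
  (forall k a, A a -> A (fun x => k * a x)) ->
  (forall a, A a -> (forall s, s \in S -> a s = 0) -> forall x, a x = 0) ->
  exists d (t : 'I_d -> T) (e : 'I_d -> T -> R), [/\ forall i, A (e i),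
    forall i j, e i (t j) = (i == j)%:R & separating A t].
Proof.
move=> AZ sepS.
have exd : exists d, `[< exists t : 'I_d -> T, separating A t >].
  exists (size S); apply/asboolP; exists (tnth (in_tuple S)) => a Aa a0.
  apply: sepS => // s sS; have /tnthP[i ->] : s \in in_tuple S by [].
  exact: a0.
case: (ex_minnP exd) => d /asboolP[t sept] mind.
have /choice[e eP] : forall i, exists e, A e /\ forall j, e (t j) = (i == j)%:R.
  case: d t sept mind => [|d] t sept mind i; first by case: i.
  have nsep : ~ separating A (t \o lift i).
    move=> sep; have : (d.+1 <= d)%N by apply: mind; apply/asboolP; exists (t \o lift i).
    by rewrite ltnn.
  (* By minimality some [a] in [A], not identically zero, vanishes at all the other points of the
     family; it cannot vanish at [t i], and rescaling gives the dual element. *)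
  move: nsep => /existsNP[a /not_implyP[Aa /not_implyP[a0 /existsNP[x ax]]]].
  have ati : a (t i) != 0.
    apply/eqP => ati; apply: ax; apply: sept => // j.
    by case: (unliftP i j) => [k|] -> //; exact: a0.
  exists (fun x => (a (t i))^-1 * a x); split; first exact: AZ.
  move=> j; case: (unliftP i j) => [k|] ->; last by rewrite mulVf ?eqxx.
  by rewrite (a0 k : a (t (lift i k)) = 0) mulr0 (negPf (neq_lift _ _)).
by exists d, t, e; split => // i; have [] := eP i.
Qed.

(** * Convexity of the exponential function *)

Lemma expR_shift (R : realType) (m u : R) : expR u = expR m * expR (u - m).
Proof. by rewrite -expRD; congr expR; ring. Qed.

(** Average the tangent line inequality at the mean [m] over [u] and [v]: the linear terms
    cancel. *)
Lemma convex_expR (R : realType) (p u v : R) : 0 <= p <= 1 ->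
  expR (p * u + (1 - p) * v) <= p * expR u + (1 - p) * expR v.
Proof.
move=> /andP[p0 p1]; set m := p * u + (1 - p) * v.
have e0 := expR_gt0 m.
have eu : expR m * (1 + (u - m)) <= expR u.
  by rewrite (expR_shift m u) ler_pM2l ?expR_ge1Dx.
have ev : expR m * (1 + (v - m)) <= expR v.
  by rewrite (expR_shift m v) ler_pM2l ?expR_ge1Dx.
have : expR m = p * (expR m * (1 + (u - m))) + (1 - p) * (expR m * (1 + (v - m))).
  by rewrite {3 5}/m; ring.
nra.
Qed.

Lemma strictly_convex_expR (R : realType) (p u v : R) : 0 < p < 1 -> u != v ->
  expR (p * u + (1 - p) * v) < p * expR u + (1 - p) * expR v.
Proof.
move=> /andP[p0 p1] uv; set m := p * u + (1 - p) * v.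
have e0 := expR_gt0 m.
have um : u - m != 0.
  rewrite (_ : u - m = (1 - p) * (u - v)); last by rewrite /m; ring.
  by rewrite mulf_neq0 ?subr_eq0// gt_eqF.
have eu : expR m * (1 + (u - m)) < expR u.
  by rewrite (expR_shift m u) ltr_pM2l ?expR_gt1Dx.
have ev : expR m * (1 + (v - m)) <= expR v.
  by rewrite (expR_shift m v) ler_pM2l ?expR_ge1Dx.
have : expR m = p * (expR m * (1 + (u - m))) + (1 - p) * (expR m * (1 + (v - m))).
  by rewrite {3 5}/m; ring.
nra.
Qed.

(** * Minima and counts over finite sequences *)

Lemma seq_min (R : realType) (T : eqType) (s : seq T) (F : T -> R) (x : T) :
  x \in s -> exists2 v, v \in s & forall u, u \in s -> F v <= F u.
Proof.
elim: s x => // a s IHs x _.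
case: s IHs => [|a' s] IHs.
  by exists a => [|u]; rewrite inE // => /eqP ->.
have [v vs vmin] := IHs a' (mem_head _ _).
have [av|va] := leP (F a) (F v).
  exists a => [|u]; first exact: mem_head.
  by rewrite inE => /predU1P[-> //|/vmin]; exact: le_trans.
exists v => [|u]; first by rewrite inE vs orbT.
by rewrite inE => /predU1P[->|/vmin //]; exact: ltW.
Qed.

Lemma count_lt (T : eqType) (a1 a2 : pred T) (s : seq T) (x : T) :
  {in s, forall u, a1 u -> a2 u} -> x \in s -> a2 x -> ~~ a1 x ->
  (count a1 s < count a2 s)%N.
Proof.
elim: s => // a s IHs sub.
have sub' : {in s, forall u, a1 u -> a2 u}.
  by move=> u us; apply: sub; rewrite inE us orbT.
have le_a : (a1 a <= a2 a)%N.
  by have := sub a (mem_head _ _); case: (a1 a) => // /(_ isT) ->.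
rewrite inE => /predU1P[<-|xs] a2x a1x /=; last first.
  by rewrite -addnS leq_add//; exact: IHs.
rewrite a2x (negPf a1x) add0n add1n ltnS.
elim: s {IHs sub} sub' => //= u s IHs sub.
rewrite leq_add ?IHs// => [|v vs]; last by apply: sub; rewrite inE vs orbT.
by have := sub u (mem_head _ _); case: (a1 u) => // /(_ isT) ->.
Qed.

(** * The operator and its supersolutions *)

Section Operator.
Variables (R : realType) (X : countType) (b : X -> X -> R) (c : X -> R).
Hypotheses (b0 : forall x y, 0 <= b x y) (lfb : locally_finite b).
Hypothesis connb : connected_graph b.

Definition neighbors (x : X) : seq X :=
  finmap.enum_fset (fset_set [set y | b x y > 0]).

Lemma mem_neighbors x y : (y \in neighbors x) = (0 < b x y).
Proof.
have := in_fset_set (lfb x) y; rewrite /neighbors => ->; exact: asboolb.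
Qed.

Definition degree (x : X) : R := \sum_(y <- neighbors x) b x y + c x.

(** Separates the diagonal term from the neighbours, whose weights are nonnegative; the positivity
    arguments below read [Hop] in this form. *)
Lemma HopE f x :
  Hop b c f x = degree x * f x - \sum_(y <- neighbors x) b x y * f y.
Proof.
rewrite /Hop fsbig_finite; last exact: lfb.
rewrite -/(neighbors x) /degree.
under eq_bigr do rewrite mulrBr.
by rewrite sumrB -mulr_suml mulrDl addrAC.
Qed.

Lemma HopZ a f x : Hop b c (fun y => a * f y) x = a * Hop b c f x.
Proof.
rewrite !HopE mulrBr mulrCA; congr (_ - _).
by rewrite mulr_sumr; apply: eq_bigr => y _; rewrite mulrCA.
Qed.

Lemma HopB f g x : Hop b c (fun y => f y - g y) x = Hop b c f x - Hop b c g x.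
Proof.
rewrite !HopE; under eq_bigr do rewrite mulrBr.
by rewrite sumrB; ring.
Qed.

Lemma connected_ind (P : X -> Prop) :
  (forall x y, P x -> 0 < b x y -> P y) -> forall x y, P x -> P y.
Proof.
move=> step x y; have [s [+ <-]] := connb x y.
by elim: s x => //= z s IHs x /andP[xz /IHs h] Px; apply: h; exact: step xz.
Qed.

Lemma connected_cross (P : X -> Prop) x y : P x -> ~ P y ->
  exists u v, [/\ P u, ~ P v & 0 < b u v].
Proof.
move=> Px nPy; apply: contrapT => nuv; apply: nPy.
apply: connected_ind Px => u v Pu uv; apply: contrapT => nPv.
by apply: nuv; exists u, v.
Qed.

Definition supersolution (mu : R) (f : X -> R) :=
  forall x, mu * f x <= Hop b c f x.

(** On an edge from [y] to [z] the supersolution inequality gives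
    [b y z * f z <= (degree y - mu) * f y]; such constants multiply along a path. *)
Lemma harnack mu x y : exists2 C, 0 < C & forall f, (forall z, 0 < f z) ->
  supersolution mu f -> f y <= C * f x.
Proof.
apply: (@connected_ind (fun y => exists2 C, 0 < C & forall f,
  (forall z, 0 < f z) -> supersolution mu f -> f y <= C * f x) _ x); last first.
  by exists 1 => // f _ _; rewrite mul1r.
move=> {}y z [C C0 hC] yz.
(* The absolute value and the added 1 only serve to make the constant positive. *)
exists ((`|degree y - mu| + 1) / b y z * C) => [|f f0 fsup].
  by rewrite mulr_gt0// divr_gt0// ltr_pwDr.
apply: (@le_trans _ _ ((`|degree y - mu| + 1) / b y z * f y)); last first.
  by rewrite -(mulrA _ C) ler_wpM2l ?hC// divr_ge0// addr_ge0.
rewrite mulrAC ler_pdivlMr//=.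
have := fsup y; rewrite HopE.
have zn : z \in neighbors y by rewrite mem_neighbors.
have : b y z * f z <= \sum_(u <- neighbors y) b y u * f u.
  rewrite (big_rem z)//= lerDl; apply: sumr_ge0 => u _.
  by rewrite mulr_ge0// ltW.
have := ler_norm (degree y - mu); have := f0 y; nra.
Qed.

Lemma eval_continuous (x : X) : continuous (fun f : {ptws X -> R} => f x).
Proof. exact: (@proj_continuous _ (fun=> R) x). Qed.

Lemma evalZ_continuous (a : R) (x : X) :
  continuous (fun f : {ptws X -> R} => a * f x).
Proof.
move=> f; apply: (@cvgM _ _ (nbhs f) _ (fun=> a) (fun h : {ptws X -> R} => h x)).
  exact: cvg_cst.
exact: (@eval_continuous x f).
Qed.

Lemma Hop_continuous (x : X) :
  continuous (fun f : {ptws X -> R} => Hop b c f x).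
Proof.
rewrite (_ : (fun _ => _) = fun f : {ptws X -> R} =>
  degree x * f x - \sum_(y <- neighbors x) b x y * f y); last first.
  by apply/funext => h; rewrite HopE.
move=> f.
apply: (@cvgB _ _ _ (nbhs f) _ (fun h : {ptws X -> R} => degree x * h x)
  (fun h : {ptws X -> R} => \sum_(y <- neighbors x) b x y * h y)).
  exact: (@evalZ_continuous (degree x) x f).
apply: (@continuous_big_sum _ _ _ _ (fun y (h : {ptws X -> R}) => b x y * h y)).
by move=> y; exact: (@evalZ_continuous (b x y) y f).
Qed.

Definition normalized_super (x0 : X) (mu : R) : set {ptws X -> R} :=
  [set f | [/\ forall x, 0 < f x, f x0 = 1 & supersolution mu f]].

(** Harnack in both directions places [f x] in a compact interval away from 0, so Tychonoff applies
    and positivity survives pointwise limits. *)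
Lemma compact_super x0 mu : compact (normalized_super x0 mu).
Proof.
have /choice[C hC] : forall y, exists C, 0 < C /\ forall f, (forall z, 0 < f z) ->
    supersolution mu f -> f y <= C * f x0.
  by move=> y; have [C] := harnack mu x0 y; exists C.
have /choice[D hD] : forall y, exists D, 0 < D /\ forall f, (forall z, 0 < f z) ->
    supersolution mu f -> f x0 <= D * f y.
  by move=> y; have [D] := harnack mu y x0; exists D.
pose K : set {ptws X -> R} := [set f | forall x, `[(D x)^-1, C x]%classic (f x)].
have cK : compact K.
  apply: (@tychonoff X (fun=> R) (fun x => `[(D x)^-1, C x]%classic)) => x.
  exact: segment_compact.
have clN : closed [set f : {ptws X -> R} | f x0 = 1].
  apply: (@closed_eq_fun _ _ (fun f : {ptws X -> R} => f x0) (fun=> 1)).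
    exact: eval_continuous.
  exact: cst_continuous.
have clS : closed [set f : {ptws X -> R} | supersolution mu f].
  apply: (@closed_all _ _ (fun x (f : {ptws X -> R}) => _ <= _)) => x.
  apply: (@closed_le_fun _ _ (fun f : {ptws X -> R} => mu * f x)
    (fun f : {ptws X -> R} => Hop b c f x)).
    exact: evalZ_continuous.
  exact: Hop_continuous.
rewrite (_ : normalized_super x0 mu =
  K `&` [set f | f x0 = 1] `&` [set f | supersolution mu f]).
  by apply: compact_closedI => //; apply: compact_closedI.
apply/seteqP; split=> f /=.
- move=> [f0 f1 fs]; split => //; split => // x; rewrite /= in_itv/=.
  have [C0 /(_ f f0 fs)] := hC x; rewrite f1 mulr1 => ->.
  by have [D0 /(_ f f0 fs)] := hD x; rewrite f1 andbT -ler_pdivrMl// mulr1.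
- move=> [[fK f1] fs]; split => // x.
  have := fK x; rewrite /= in_itv/= => /andP[+ _]; apply: lt_le_trans.
  by rewrite invr_gt0; have [] := hD x.
Qed.

(** * Group action and quasi-invariant functions *)

Section GroupAction.
Variables (G : groupType) (act : G -> X -> X) (x0 : X).
Hypotheses (actP : is_action act) (cocom : cocompact act).
Hypothesis invb : G_invariant act b c.

Lemma actK g x : act g (act g^-1%g x) = x.
Proof. by case: actP => act1 actM; rewrite -actM mulgV act1. Qed.

Definition quasi_invariant (gam : G -> R) (f : X -> R) :=
  forall g x, f (act g x) = gam g * f x.

Lemma Hop_quasi_invariant gam f :
  quasi_invariant gam f -> quasi_invariant gam (Hop b c f).
Proof.
move=> qf g x; have := invb g^-1%g f x.
rewrite [RHS]/Tg invgK => <-; rewrite -HopZ; congr Hop.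
by apply/funext => y; rewrite /Tg invgK.
Qed.

Lemma quasi_invariantB gam f h : quasi_invariant gam f -> quasi_invariant gam h ->
  quasi_invariant gam (fun x => f x - h x).
Proof. by move=> qf qh g x; rewrite qf qh mulrBr. Qed.

Lemma quasi_invariantZ gam a f : quasi_invariant gam f ->
  quasi_invariant gam (fun x => a * f x).
Proof. by move=> qf g x; rewrite qf mulrCA. Qed.

Lemma exists_fundamental : exists Vs : seq X,
  forall x, exists g v, v \in Vs /\ x = act g v.
Proof.
have [V [finV VG]] := cocom.
exists (finmap.enum_fset (fset_set V)) => x; have [g [v [Vv ->]]] := VG x.
exists g, v; split => //; have := in_fset_set finV v => ->.
exact/mem_set.
Qed.

Definition fundamental : seq X := projT1 (cid exists_fundamental).

Lemma fundamentalP x : exists g v, v \in fundamental /\ x = act g v.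
Proof. exact: (projT2 (cid exists_fundamental)). Qed.

Lemma fundamental_point : exists v, v \in fundamental.
Proof. by have [g [v []]] := fundamentalP x0; exists v. Qed.

(** Along an orbit both sides scale by the same positive factor, so finitely many points decide. *)
Lemma quasi_invariant_le gam f h : (forall g, 0 < gam g) ->
  quasi_invariant gam f -> quasi_invariant gam h ->
  (forall v, v \in fundamental -> f v <= h v) -> forall x, f x <= h x.
Proof.
move=> gam0 qf qh fh x; have [g [v [vV ->]]] := fundamentalP x.
by rewrite qf qh ler_wpM2l ?fh// ltW.
Qed.

Lemma quasi_invariant_lt gam f h : (forall g, 0 < gam g) ->
  quasi_invariant gam f -> quasi_invariant gam h ->
  (forall v, v \in fundamental -> f v < h v) -> forall x, f x < h x.
Proof.
move=> gam0 qf qh fh x; have [g [v [vV ->]]] := fundamentalP x.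
by rewrite qf qh ltr_pM2l ?fh.
Qed.

(** The ratio [h / f] is constant on orbits, so its infimum is attained on the fundamental
    domain. *)
Lemma quasi_invariant_min_ratio gam f h : (forall g, 0 < gam g) ->
  (forall x, 0 < f x) -> quasi_invariant gam f -> quasi_invariant gam h ->
  exists v, forall x, h v / f v * f x <= h x.
Proof.
move=> gam0 f0 qf qh; have [v1 v1V] := fundamental_point.
have [v vV vmin] := seq_min (fun x => h x / f x) v1V.
exists v; apply: (quasi_invariant_le (gam := gam)) => //.
  exact: quasi_invariantZ.
by move=> u /vmin; rewrite ler_pdivlMr.
Qed.

Definition eigenfunction (lam : R) (f : X -> R) :=
  forall x, Hop b c f x = lam * f x.

Lemma sum_neighbors_ge0 w x : (forall y, 0 <= w y) ->
  0 <= \sum_(y <- neighbors x) b x y * w y.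
Proof. by move=> w0; apply: sumr_ge0 => y _; rewrite mulr_ge0. Qed.

Lemma sum_neighbors_gt0 w x y : (forall z, 0 <= w z) -> 0 < b x y -> 0 < w y ->
  0 < \sum_(z <- neighbors x) b x z * w z.
Proof.
move=> w0 xy wy.
rewrite (big_rem y) ?mem_neighbors//= ltr_pwDl ?mulr_gt0//.
by apply: sumr_ge0 => z _; rewrite mulr_ge0.
Qed.

(* Compare [h] with the largest multiple of [f] below it: at a point of contact
   the operator sees only the nonpositive contribution of the neighbours. *)
Lemma eigenvalue_comparison gam lam mu f h : (forall g, 0 < gam g) ->
  (forall x, 0 < f x) -> (forall x, 0 < h x) ->
  quasi_invariant gam f -> quasi_invariant gam h -> f x0 = 1 -> h x0 = 1 ->
  eigenfunction lam f -> supersolution mu h ->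
  mu <= lam /\ (mu = lam -> h = f).
Proof.
move=> gam0 f0 h0 qf qh f1 h1 ef sh.
have [v vmin] := quasi_invariant_min_ratio gam0 f0 qf qh.
set m := h v / f v in vmin.
pose w x := h x - m * f x.
have w0 x : 0 <= w x by rewrite subr_ge0.
have Hw x : Hop b c w x = Hop b c h x - m * (lam * f x).
  by rewrite HopB (HopZ m f) ef.
(* At a contact point [h x = m * f x], so [Hop b c w x] is at least [(mu - lam) * h x], while it
   equals minus the sum over the neighbours. *)
have key x : w x = 0 ->
    (mu - lam) * h x + \sum_(y <- neighbors x) b x y * w y <= 0.
  move=> wx; have := Hw x; rewrite HopE wx mulr0.
  have : h x = m * f x by move/eqP: wx; rewrite subr_eq0 => /eqP.
  have := sh x; set S := \sum_(_ <- _) _.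
  by move=> shx hx e; move: shx; rewrite hx; nra.
have wv : w v = 0 by rewrite /w /m divfK ?subrr// gt_eqF.
split.
  have := key v wv; have := sum_neighbors_ge0 v w0; have := h0 v.
  by rewrite leNgt => hv S0 k; apply/negP => ?; nra.
move=> mulam.
(* For [mu = lam] the sum in [key] must vanish, so contact spreads along edges to all of [X]; the
   normalization at [x0] then gives [m = 1]. *)
have wx x : w x = 0.
  apply: (@connected_ind (fun x => w x = 0) _ v x wv) => y z wy yz.
  apply: contrapT => /eqP wz.
  have := key y wy; rewrite mulam subrr mul0r add0r leNgt => /negP; apply.
  by apply: (sum_neighbors_gt0 w0 yz); rewrite lt_neqAle eq_sym wz w0.
have m1 : m = 1 by have := wx x0; rewrite /w f1 h1; lra.
by apply/funext => x; have := wx x; rewrite /w m1; lra.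
Qed.

(** * Existence of eigenfunctions with a given character *)

Definition quasi_super (gam : G -> R) (mu : R) : set {ptws X -> R} :=
  normalized_super x0 mu `&` [set f | quasi_invariant gam f].

Lemma compact_quasi_super gam mu : compact (quasi_super gam mu).
Proof.
apply: compact_closedI; first exact: compact_super.
apply: (@closed_all _ _ (fun g (f : {ptws X -> R}) =>
  forall x, f (act g x) = gam g * f x)) => g.
apply: (@closed_all _ _ (fun x (f : {ptws X -> R}) =>
  f (act g x) = gam g * f x)) => x.
apply: (@closed_eq_fun _ _ (fun f : {ptws X -> R} => f (act g x))
  (fun f : {ptws X -> R} => gam g * f x)).
  exact: eval_continuous.
exact: evalZ_continuous.
Qed.

Lemma quasi_super_mono gam mu mu' : mu' <= mu ->
  quasi_super gam mu `<=` quasi_super gam mu'.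
Proof.
move=> le_mu f [[f0 f1 fs] qf]; split => //; split => // x.
by apply: le_trans (fs x); rewrite ler_wpM2r// ltW.
Qed.

Lemma quasi_super_bound gam mu f : quasi_super gam mu f -> mu <= degree x0.
Proof.
move=> [[f0 f1 fs] _]; have := fs x0; rewrite HopE f1 !mulr1.
have := @sum_neighbors_ge0 f x0 (fun y => ltW (f0 y)); lra.
Qed.

(** Evaluation at [x0] bounds the admissible [mu]; the supremum is attained because the nested
    compact sets at the levels [sup E - e] have a common point. *)
Lemma maximal_quasi_super gam : (exists mu, quasi_super gam mu !=set0) ->
  exists mus, quasi_super gam mus !=set0 /\
    forall mu, quasi_super gam mu !=set0 -> mu <= mus.
Proof.
move=> exS; pose E := [set mu | quasi_super gam mu !=set0].
have supE : has_sup E.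
  split; first exact: exS.
  by exists (degree x0) => mu [f /quasi_super_bound].
have ubE := sup_upper_bound supE.
exists (sup E); split; last by move=> mu Emu; exact: ubE.
pose F := filter_from [set e : R | 0 < e] (fun e => quasi_super gam (sup E - e)).
have FF : Filter F.
  apply: filter_from_filter; first by exists 1; exact: ltr01.
  move=> e1 e2 /= e10 e20; exists (Num.min e1 e2).
    by rewrite /= lt_min e10.
  by move=> f Sf; split; apply: quasi_super_mono Sf;
    rewrite lerD2l lerN2 ge_min lexx ?orbT.
have PF : ProperFilter F.
  apply: filter_from_proper => e /= e0.
  have [mu [f Sf] ltmu] := sup_adherent e0 supE.
  by exists f; apply: quasi_super_mono Sf; exact: ltW.
have Fe e : 0 < e -> F (quasi_super gam (sup E - e)) by move=> e0; exists e.
have [f [Sf clf]] := compact_quasi_super PF (Fe 1 ltr01).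
have Sfe e : 0 < e -> quasi_super gam (sup E - e) f.
  move=> e0; have cS : closed (quasi_super gam (sup E - e)).
    apply: compact_closed; last exact: compact_quasi_super.
    by apply: (@hausdorff_product X (fun=> R)) => x; exact: Rhausdorff.
  by apply: cS => C fC; apply: clf => //; exact: Fe.
exists f; case: Sf => [[f0 f1 _] qf]; split => //; split => // x.
(* The level is lowered by [e / f x] so that the loss at [x] is exactly [e]. *)
apply/ler_addgt0Pr => e e0.
have [[_ _ /(_ x) fx] _] := Sfe (e / f x) (divr_gt0 e0 (f0 x)).
by move: fx; rewrite mulrBl divfK ?gt_eqF// lerBlDr.
Qed.

(* A maximal supersolution [f] with the fewest points of equality in the
   fundamental domain is an eigenfunction: [tau - H] maps [f] to a supersolution
   with fewer points of equality unless [H f - mu f] vanishes or is positive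
   everywhere, and the latter contradicts maximality. *)
Lemma exists_eigenfunction gam f0 : (forall g, 0 < gam g) ->
  (forall x, 0 < f0 x) -> quasi_invariant gam f0 ->
  exists f lam, [/\ forall x, 0 < f x, f x0 = 1, quasi_invariant gam f &
    eigenfunction lam f].
Proof.
move=> gam0 f0_gt0 qf0.
have normalize mu h : (forall x, 0 < h x) -> quasi_invariant gam h ->
    supersolution mu h -> quasi_super gam mu (fun x => (h x0)^-1 * h x).
  move=> h0 qh sh; split; last exact: quasi_invariantZ.
  split; first by move=> x; rewrite mulr_gt0// invr_gt0.
    by rewrite mulVf// gt_eqF.
  by move=> x; rewrite HopZ mulrCA ler_wpM2l// invr_ge0 ltW.
have [v1 v1V] := fundamental_point.
have [|mus [[fs Sfs] maxmus]] := @maximal_quasi_super gam.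
  (* The least value of [Hop b c f0 / f0], attained on the fundamental domain, is an admissible
     [mu]. *)
  have [v vV vmin] := seq_min (fun x => Hop b c f0 x / f0 x) v1V.
  exists (Hop b c f0 v / f0 v), (fun x => (f0 x0)^-1 * f0 x).
  apply: normalize => //.
  apply: (@quasi_invariant_le gam (fun x => _ * f0 x) (Hop b c f0) gam0).
  - exact: quasi_invariantZ.
  - exact: Hop_quasi_invariant.
  - by move=> u /vmin; rewrite ler_pdivlMr.
pose w (f : X -> R) x := Hop b c f x - mus * f x.
pose N f := count (fun v => w f v == 0) fundamental.
have exN : exists n, `[< exists f, quasi_super gam mus f /\ N f = n >].
  by exists (N fs); apply/asboolP; exists fs.
case: (ex_minnP exN) => n /asboolP[f [Sf Nf]] nmin.
have [[fp f1 fsup] qf] := Sf.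
have qw : quasi_invariant gam (w f).
  apply: quasi_invariantB; first exact: Hop_quasi_invariant.
  exact: quasi_invariantZ.
have w0 x : 0 <= w f x by rewrite subr_ge0.
exists f, mus; split => //.
apply: contrapT => /existsNP[y /eqP]; rewrite -subr_eq0 -/(w f y) => wy.
have {}wy : 0 < w f y by rewrite lt_neqAle eq_sym wy w0.
have [wpos|/existsNP[x1 /negP]] := pselect (forall x, 0 < w f x).
  have [v vV vmin] := seq_min (fun x => w f x / f x) v1V.
  have : mus + w f v / f v <= mus.
    apply: maxmus; exists f; split => //; split => //.
    apply: (@quasi_invariant_le gam (fun x => _ * f x) (Hop b c f) gam0).
    - exact: quasi_invariantZ.
    - exact: Hop_quasi_invariant.
    - by move=> u /vmin; rewrite ler_pdivlMr// /w; lra.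
  by rewrite gerDl leNgt divr_gt0.
rewrite -leNgt => wx.
have {}wx : w f x1 = 0 by apply/eqP; rewrite eq_le wx w0.
have [|u [z [wu /eqP wz uz]]] := @connected_cross (fun x => w f x = 0) x1 y wx.
  by apply/eqP; rewrite gt_eqF.
have {}wz : 0 < w f z by rewrite lt_neqAle eq_sym wz w0.
(* [tau] exceeds the degree on the fundamental domain, so [tau - H] has there a positive diagonal
   and nonnegative weights on the neighbours. *)
pose tau := 1 + \sum_(v <- fundamental) `|degree v|.
have tau_gt v : v \in fundamental -> degree v < tau.
  move=> vV; rewrite /tau (big_rem v)//= addrCA.
  have : 0 <= \sum_(u <- rem v fundamental) `|degree u| by apply: sumr_ge0.
  by have := ler_norm (degree v); lra.
pose P (h : X -> R) x := tau * h x - Hop b c h x.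
have PE h x : P h x =
    (tau - degree x) * h x + \sum_(y <- neighbors x) b x y * h y.
  by rewrite /P HopE; ring.
have qP h : quasi_invariant gam h -> quasi_invariant gam (P h).
  move=> qh; apply: quasi_invariantB; first exact: quasi_invariantZ.
  exact: Hop_quasi_invariant.
have wP h v : w (P h) v = P (w h) v.
  rewrite /w /P !HopB !(HopZ mus) !(HopZ tau); ring.
have q0 : quasi_invariant gam (fun=> 0) by move=> g v; rewrite mulr0.
have P0 v : 0 < P f v.
  move: v; apply: (@quasi_invariant_lt gam (fun=> 0) _ gam0) => //.
    exact: qP.
  move=> v vV; rewrite PE ltr_pwDl//; last first.
    by apply: sum_neighbors_ge0 => ?; exact: ltW.
  by rewrite mulr_gt0// subr_gt0 tau_gt.
have wP0 v : 0 <= w (P f) v.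
  move: v; apply: (@quasi_invariant_le gam (fun=> 0) _ gam0) => //.
    by apply: quasi_invariantB; [apply: Hop_quasi_invariant|
      apply: quasi_invariantZ]; exact: qP.
  move=> v vV; rewrite wP PE addr_ge0 ?sum_neighbors_ge0//.
  by rewrite mulr_ge0// subr_ge0 ltW// tau_gt.
(* The new defect is a positive multiple of [P (w f)], which can vanish on the fundamental domain
   only where [w f] does. It is positive at [u], a zero of [w f] with the neighbour [z] outside the
   zero set, hence also at the representative [v] of [u]. *)
have NP : (N (fun x => (P f x0)^-1 * P f x)%R < N f)%N.
  have wZ v : (w (fun x => (P f x0)^-1 * P f x) v == 0) = (P (w f) v == 0).
    rewrite -wP /w HopZ mulrCA -mulrBr mulf_eq0 invr_eq0.
    by rewrite (gt_eqF (P0 x0)).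
  have [g [v [vV uE]]] := fundamentalP u.
  have wv : w f v = 0.
    by move: wu; rewrite uE qw => /eqP; rewrite mulf_eq0 gt_eqF//= => /eqP.
  apply: (count_lt (x := v)) => //.
  - move=> t tV; rewrite wZ => /eqP Pwt; rewrite eq_le w0 andbT leNgt.
    apply/negP => wt; move: Pwt; apply/eqP; rewrite gt_eqF// PE ltr_pwDl//.
      by rewrite mulr_gt0// subr_gt0 tau_gt.
    exact: sum_neighbors_ge0.
  - by rewrite wv.
  - have : 0 < P (w f) u.
      by rewrite PE wu mulr0 add0r; exact: sum_neighbors_gt0 wz.
    by rewrite uE (qP _ qw) pmulr_rgt0// wZ => /gt_eqF ->.
have : (n <= N (fun x => (P f x0)^-1 * P f x)%R)%N.
  apply: nmin; apply/asboolP; eexists; split; last by [].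
  by apply: normalize => //; [exact: qP|move=> v; rewrite -subr_ge0; exact: wP0].
by rewrite leqNgt -Nf NP.
Qed.

(** * Characters *)

(** Invariance is assumed of the operator, so the weight is recovered by applying [Hop] to the
    indicator of [y] and evaluating at [x], which yields [- b x y]. Loops cancel in [Hop], hence the
    condition [x != y]. *)
Lemma edge_act g x y : x != y -> 0 < b x y -> 0 < b (act g x) (act g y).
Proof.
move=> xy bxy; pose dl (u : X) : X -> R := fun z => (z == u)%:R.
have Hdl u z : z != u -> Hop b c (dl u) z = - b z u.
  move=> zu; rewrite HopE /dl (negPf zu) mulr0 sub0r; congr (- _).
  have [uz|uz] := boolP (u \in neighbors z).
    rewrite (big_rem u)//= eqxx mulr1 big_seq big1 ?addr0// => v vz.
    have un : uniq (neighbors z) by exact: finmap.fset_uniq.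
    by move: vz; rewrite mem_rem_uniq// inE => /andP[/negPf -> _]; rewrite mulr0.
  have bzu : b z u = 0.
    apply/eqP; rewrite eq_le b0 andbT leNgt; apply: contra uz.
    by rewrite mem_neighbors.
  rewrite bzu big_seq big1// => v vz; case: eqP => [vu|_]; last by rewrite mulr0.
  by rewrite vu bzu mul0r.
case: (actP) => act1 actM.
have actKV z : act g^-1%g (act g z) = z by rewrite -actM mulVg act1.
have inj z z' : (act g z == act g z') = (z == z').
  by apply/eqP/eqP => [/(congr1 (act g^-1%g))|-> //]; rewrite !actKV.
have := invb g (dl y) (act g x); rewrite [RHS]/Tg actKV Hdl//.
have -> : Tg act g (dl y) = dl (act g y).
  by apply/funext => z; rewrite /Tg /dl -inj actK.
by rewrite Hdl ?inj// => /oppr_inj ->.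
Qed.

(* For a homomorphism [a] such an [l] exists exactly when [a] vanishes on the
   stabilizers of all points. *)
Definition displacement (l : X -> R) (a : G -> R) :=
  forall g x, l (act g x) = l x + a g.

Definition characters : set (G -> R) := [set a | exists l, displacement l a].

Lemma displacementM l a g h : displacement l a -> a (g * h)%g = a g + a h.
Proof.
case: actP => _ actM dl; have := dl (g * h)%g x0.
by rewrite actM !dl; lra.
Qed.

Lemma displacement1 l a : displacement l a -> a 1%g = 0.
Proof. by move=> /(@displacementM _ _ 1%g 1%g); rewrite mulg1; lra. Qed.

(** Along the powers of [g] the function [l] changes by [n * a g], which is unbounded unless
    [a g = 0]. *)
Lemma displacement_bounded l a M : displacement l a ->
  (forall x, `|l x| <= M) -> forall g, a g = 0.
Proof.
move=> dl lM g.
have dX n : l (act (g ^+ n)%g x0) = l x0 + n%:R * a g.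
  rewrite dl; congr (_ + _); elim: n => [|n IHn].
    by rewrite expg0 mul0r (displacement1 dl).
  by rewrite expgS (displacementM _ _ dl) IHn -natr1; ring.
apply/eqP/negPn/negP => ag0.
have ag : 0 < `|a g| by rewrite normr_gt0.
have M0 : 0 <= M by apply: le_trans (lM x0).
have [n hn] : exists n : nat, (2 * M + 1) / `|a g| < n%:R.
  by exists (Num.truncn ((2 * M + 1) / `|a g|)).+1; exact: truncnS_gt.
move: hn; rewrite ltr_pdivrMr//.
have -> : n%:R * `|a g| = `|l (act (g ^+ n)%g x0) - l x0|.
  by rewrite dX addrAC subrr add0r normrM normr_nat.
have := ler_normB (l (act (g ^+ n)%g x0)) (l x0).
have := lM x0; have := lM (act (g ^+ n)%g x0); lra.
Qed.

(** [S] consists of elements that carry a point of the fundamental domain to a neighbour of such a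
    point. If [a] vanishes on [S], a path from [v0] shows that every point is [act g v] with [v] in
    the domain and [a g = 0]; so [l] takes only its values on the domain and is bounded. *)
Lemma characters_separated : exists S : seq G, forall a, characters a ->
  (forall s, s \in S -> a s = 0) -> forall g, a g = 0.
Proof.
have /choice[k kP] : forall x, exists g, exists2 v, v \in fundamental & x = act g v.
  by move=> x; have [g [v [vV xE]]] := fundamentalP x; exists g, v.
exists [seq k y | v <- fundamental, y <- neighbors v] => a [l dl] aS.
have [v0 v0V] := fundamental_point; case: (actP) => act1 actM.
pose P x := exists g v, [/\ v \in fundamental, x = act g v & a g = 0].
have Pall x : P x.
  apply: (@connected_ind P _ v0); last first.
    by exists 1%g, v0; rewrite act1 (displacement1 dl).
  move=> _ y [g [v [vV -> ag]]] gy.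
  have [<-|yn] := eqVneq (act g v) y; first by exists g, v.
  (* The edge is first pulled back by [g] so that it starts in the fundamental domain. *)
  have [v' v'V yE] := kP (act g^-1%g y).
  have vy : act g^-1%g y \in neighbors v.
    by rewrite mem_neighbors -[v](actK g^-1%g) invgK edge_act.
  exists (g * k (act g^-1%g y))%g, v'; split => //.
    by rewrite actM -yE actK.
  rewrite (displacementM _ _ dl) ag add0r; apply: aS.
  by apply/allpairsPdep; exists v, (act g^-1%g y).
apply: (displacement_bounded (M := \sum_(v <- fundamental) `|l v|) dl) => x.
have [g [v [vV -> ag]]] := Pall x.
by rewrite dl ag addr0 (big_rem v)//= lerDl sumr_ge0.
Qed.

(** * Multiplicative eigenfunctions *)

Definition positive_multiplicative (f : X -> R) :=
  [/\ forall x, 0 < f x, f x0 = 1 & quasi_invariant (fun g => f (act g x0)) f].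

(** Since [f x0 = 1], the eigenvalue is [Hop b c f x0]; this puts all eigenvalues into one set, on
    which the eigenvalue is a continuous function. *)
Definition multiplicative_eigen : set {ptws X -> R} :=
  [set f | positive_multiplicative f /\ eigenfunction (Hop b c f x0) f].

(** Minimum principle: at a zero of [f] the equation forces all neighbours to be zeros, and a path
    leads to [x0], where [f] is 1. *)
Lemma harmonic_positive mu f : (forall x, 0 <= f x) -> f x0 = 1 ->
  eigenfunction mu f -> forall x, 0 < f x.
Proof.
move=> f0 f1 ef x; rewrite lt_neqAle f0 andbT eq_sym; apply/eqP => fx.
have : f x0 = 0; last by move/eqP; rewrite f1 oner_eq0.
apply: (@connected_ind (fun x => f x = 0) _ x _ fx) => u v fu uv.
apply/eqP; rewrite eq_le f0 andbT leNgt; apply/negP => fv.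
have := sum_neighbors_gt0 f0 uv fv.
have := ef u; rewrite HopE fu !mulr0; lra.
Qed.

(** Nonnegativity, the eigenvalue equation and the normalization are closed conditions, so they hold
    on the whole closure [Kset]. *)
Lemma MsetE mu f : Mset act b c x0 mu f <->
  multiplicative_eigen f /\ Hop b c f x0 = mu.
Proof.
split=> [[Kf [gam [gamM [gam0 gamf]]]]|[[[f0 f1 qf] ef] fmu]].
- have [fge0 ef f1] : [/\ forall x, 0 <= f x, eigenfunction mu f & f x0 = 1].
    pose C : set {ptws X -> R} := [set f | forall x, 0 <= f x] `&`
      [set f | forall x, Hop b c f x = mu * f x] `&` [set f | f x0 = 1].
    have clC : closed C.
      apply: closedI; first apply: closedI.
      - apply: (@closed_all _ _ (fun x (f : {ptws X -> R}) => 0 <= f x)) => x.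
        apply: (@closed_le_fun _ _ (fun=> 0) (fun f : {ptws X -> R} => f x)).
          exact: cst_continuous.
        exact: eval_continuous.
      - apply: (@closed_all _ _ (fun x (f : {ptws X -> R}) =>
          Hop b c f x = mu * f x)) => x.
        apply: (@closed_eq_fun _ _ (fun f : {ptws X -> R} => Hop b c f x)
          (fun f : {ptws X -> R} => mu * f x)).
          exact: Hop_continuous.
        exact: evalZ_continuous.
      - apply: (@closed_eq_fun _ _ (fun f : {ptws X -> R} => f x0) (fun=> 1)).
          exact: eval_continuous.
        exact: cst_continuous.
    have sC : pos_harm_normalized b c x0 mu `<=` C.
      move=> h [h0 [_ [eh h1]]]; split => //; split => // x.
      by apply/eqP; rewrite -subr_eq0; apply/eqP; exact: eh.
    by have [[]] := clC f (closureS sC Kf).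
  have fp := harmonic_positive fge0 f1 ef.
  have fg g x : f (act g x) = gam g * f x.
    by have := congr1 (fun h => h x) (gamf g^-1%g); rewrite /Tg invgK.
  have qf : quasi_invariant (fun g => f (act g x0)) f.
    by move=> g x; rewrite !fg f1 mulr1.
  have fmu : Hop b c f x0 = mu by rewrite ef f1 mulr1.
  by split => //; split; [split|rewrite fmu].
- split.
    apply: subset_closure; split; first by move=> x; exact: ltW.
    split; first by exists x0; rewrite f1 oner_neq0.
    by split => // x; rewrite ef fmu subrr.
  exists (fun g => f (act g x0)); split; first by case: actP => _ aM g h; rewrite aM qf.
  by split=> g; [|apply/funext => x; exact: qf].
Qed.

Lemma multiplicative_of_eigenfunction gam lam f : (forall x, 0 < f x) ->
  f x0 = 1 -> quasi_invariant gam f -> eigenfunction lam f ->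
  multiplicative_eigen f.
Proof.
move=> f0 f1 qf ef; split; first split => //.
  by move=> g x; rewrite !qf f1 mulr1.
by move=> x; rewrite !ef f1 mulr1.
Qed.

(** An eigenvalue of at least [mu] makes [f] a supersolution for [mu], and the other conditions are
    closed in the compact set of these. *)
Lemma compact_multiplicative_ge mu :
  compact (multiplicative_eigen `&` [set f | mu <= Hop b c f x0]).
Proof.
rewrite (_ : _ `&` _ = normalized_super x0 mu `&`
    [set f | forall g x, f (act g x) = f (act g x0) * f x] `&`
    [set f | forall x, Hop b c f x = Hop b c f x0 * f x]).
  apply: compact_closedI; first apply: compact_closedI.
  - exact: compact_super.
  - apply: (@closed_all _ _ (fun g (f : {ptws X -> R}) => forall x,
      f (act g x) = f (act g x0) * f x)) => g.
    apply: (@closed_all _ _ (fun x (f : {ptws X -> R}) =>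
      f (act g x) = f (act g x0) * f x)) => x.
    apply: (@closed_eq_fun _ _ (fun f : {ptws X -> R} => f (act g x))
      (fun f : {ptws X -> R} => f (act g x0) * f x)).
      exact: eval_continuous.
    move=> f; apply: (@cvgM _ _ (nbhs f) _ (fun f : {ptws X -> R} => f (act g x0))
      (fun h : {ptws X -> R} => h x)).
      exact: (@eval_continuous (act g x0) f).
    exact: (@eval_continuous x f).
  - apply: (@closed_all _ _ (fun x (f : {ptws X -> R}) =>
      Hop b c f x = Hop b c f x0 * f x)) => x.
    apply: (@closed_eq_fun _ _ (fun f : {ptws X -> R} => Hop b c f x)
      (fun f : {ptws X -> R} => Hop b c f x0 * f x)).
      exact: Hop_continuous.
    move=> f; apply: (@cvgM _ _ (nbhs f) _ (fun f : {ptws X -> R} => Hop b c f x0)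
      (fun h : {ptws X -> R} => h x)).
      exact: (@Hop_continuous x0 f).
    exact: (@eval_continuous x f).
apply/seteqP; split=> f /=.
- move=> [[[f0 f1 qf] ef] le_mu]; split => //; split => //; split => // x.
  by rewrite ef ler_wpM2r// ltW.
- move=> [[[f0 f1 fs] qf] ef]; split; first by split.
  by have := fs x0; rewrite f1 mulr1.
Qed.

Lemma displacement_ln f : positive_multiplicative f ->
  displacement (fun x => ln (f x)) (fun g => ln (f (act g x0))).
Proof. by move=> [f0 f1 qf] g x; rewrite qf lnM ?posrE// addrC. Qed.

Lemma displacement_exp l a : displacement l a ->
  positive_multiplicative (fun x => expR (l x - l x0)).
Proof.
move=> dl; split=> [x||g x]; first exact: expR_gt0.
  by rewrite subrr expR0.
by rewrite !dl -expRD; congr expR; ring.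
Qed.

(** * Coordinates on the space of characters *)

Section Coordinates.
Variables (d : nat) (t : 'I_d -> G) (e : 'I_d -> G -> R) (L : 'I_d -> X -> R).
Hypotheses (eL : forall i, displacement (L i) (e i)).
Hypothesis et : forall i j, e i (t j) = (i == j)%:R.
Hypothesis sept : separating characters t.

Definition log_coord (f : X -> R) : 'rV[R]_d := \row_i ln (f (act (t i) x0)).

(** The difference of the two logarithmic characters vanishes at every [t i], hence everywhere. *)
Lemma log_coord_quasi_invariant f h : positive_multiplicative f ->
  positive_multiplicative h -> log_coord f = log_coord h ->
  quasi_invariant (fun g => f (act g x0)) h.
Proof.
move=> pf ph fh; have [f0 _ _] := pf; have [h0 _ qh] := ph.
suff e0 g : ln (f (act g x0)) - ln (h (act g x0)) = 0.
  move=> g x; rewrite qh; congr (_ * _); apply/esym.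
  apply: (ln_inj (f0 _) (h0 _)).
  by apply/eqP; rewrite -subr_eq0 e0.
apply: (sept (a := fun g => ln (f (act g x0)) - ln (h (act g x0)))).
  exists (fun x => ln (f x) - ln (h x)) => k x.
  by rewrite (displacement_ln pf k x) (displacement_ln ph k x); ring.
move=> i; have := congr1 (fun v : 'rV_d => v ord0 i) fh.
by rewrite !mxE => ->; rewrite subrr.
Qed.

Lemma supersolution_le f h mu : multiplicative_eigen f ->
  positive_multiplicative h -> log_coord f = log_coord h ->
  supersolution mu h -> mu <= Hop b c f x0 /\ (mu = Hop b c f x0 -> h = f).
Proof.
move=> [pf ef] ph fh sh; have [f0 f1 qf] := pf; have [h0 h1 qh] := ph.
apply: (@eigenvalue_comparison (fun g => f (act g x0))) => //.
exact: log_coord_quasi_invariant.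
Qed.

Lemma eigen_supersolution f : eigenfunction (Hop b c f x0) f ->
  supersolution (Hop b c f x0) f.
Proof. by move=> ef x; rewrite (ef x). Qed.

Lemma log_coord_inj f h : multiplicative_eigen f -> multiplicative_eigen h ->
  log_coord f = log_coord h -> f = h.
Proof.
move=> mf mh fh.
have [lhf eqhf] := supersolution_le mf (proj1 mh) fh (eigen_supersolution (proj2 mh)).
have [lfh _] :=
  supersolution_le mh (proj1 mf) (esym fh) (eigen_supersolution (proj2 mf)).
by apply/esym/eqhf/eqP; rewrite eq_le lhf.
Qed.

(** A test function with prescribed coordinates, in general no eigenfunction. *)
Definition exp_coord (v : 'rV[R]_d) (x : X) : R :=
  expR (\sum_i v ord0 i * L i x - \sum_i v ord0 i * L i x0).

Lemma displacement_coord (v : 'rV[R]_d) : displacement (fun x => \sum_i v ord0 i * L i x)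
  (fun g => \sum_i v ord0 i * e i g).
Proof.
move=> g x; rewrite -big_split; apply: eq_bigr => i _ /=.
by rewrite eL mulrDr.
Qed.

Lemma exp_coord_multiplicative v : positive_multiplicative (exp_coord v).
Proof. exact: displacement_exp (displacement_coord v). Qed.

Lemma log_coordK v : log_coord (exp_coord v) = v.
Proof.
apply/rowP => j; rewrite mxE /exp_coord displacement_coord addrAC subrr add0r expRK.
rewrite (bigD1 j)//= et eqxx mulr1 big1 ?addr0// => i /negPf ij.
by rewrite et ij mulr0.
Qed.

Lemma log_coord_surj v : exists f, multiplicative_eigen f /\ log_coord f = v.
Proof.
have [h0 h1 qh] := exp_coord_multiplicative v.
have [f [lam [f0 f1 qf ef]]] :=
  exists_eigenfunction (fun g => h0 (act g x0)) h0 qh.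
exists f; split; first exact: (multiplicative_of_eigenfunction f0 f1 qf ef).
rewrite -[RHS]log_coordK; apply/rowP => j; rewrite !mxE; congr ln.
by rewrite qf f1 mulr1.
Qed.

(** The ratio of [exp_coord v] across an edge is bounded in terms of [rho]. This makes it a
    supersolution for a constant depending only on [rho], and comparison bounds the eigenvalue. *)
Lemma eigenvalue_lower_bound rho : exists mu, forall f, multiplicative_eigen f ->
  (forall i, `|log_coord f ord0 i| <= rho) -> mu <= Hop b c f x0.
Proof.
pose m x := degree x -
  \sum_(y <- neighbors x) b x y * expR (\sum_i rho * `|L i y - L i x|).
have [v1 v1V] := fundamental_point; have [w wV wmin] := seq_min m v1V.
exists (m w) => f mf frho; pose v := log_coord f.
have [h0 h1 qh] := exp_coord_multiplicative v.
suff sh : supersolution (m w) (exp_coord v).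
  by have [] := supersolution_le mf (exp_coord_multiplicative v)
    (esym (log_coordK v)) sh.
apply: (@quasi_invariant_le _ (fun x => m w * exp_coord v x)
  (Hop b c (exp_coord v)) (fun g => h0 (act g x0))).
- exact: quasi_invariantZ.
- exact: Hop_quasi_invariant.
move=> x xV; apply: (@le_trans _ _ (m x * exp_coord v x)).
  by rewrite ler_wpM2r ?wmin// ltW.
rewrite HopE /m mulrBl lerD2l lerN2 mulr_suml; apply: ler_sum => y _.
rewrite -mulrA ler_wpM2l// /exp_coord -expRD ler_expR addrA lerD2r.
rewrite -lerBlDr -sumrB; apply: ler_sum => i _; rewrite -mulrBr.
apply: le_trans (ler_norm _) _; rewrite normrM ler_wpM2r//.
Qed.

(* The weighted geometric mean of two eigenfunctions is a supersolution, by
   convexity of [expR] on each edge. *)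
Lemma eigenvalue_concave p f1 f2 f : 0 <= p <= 1 ->
  multiplicative_eigen f1 -> multiplicative_eigen f2 -> multiplicative_eigen f ->
  log_coord f = p *: log_coord f1 + (1 - p) *: log_coord f2 ->
  p * Hop b c f1 x0 + (1 - p) * Hop b c f2 x0 <= Hop b c f x0 /\
  (0 < p < 1 -> f1 <> f2 ->
     p * Hop b c f1 x0 + (1 - p) * Hop b c f2 x0 < Hop b c f x0).
Proof.
move=> p01 [pf1 ef1] [pf2 ef2] mf fE.
set mu := p * _ + _.
have [f10 f11 qf1] := pf1; have [f20 f21 qf2] := pf2.
pose l x := p * ln (f1 x) + (1 - p) * ln (f2 x); pose h x := expR (l x - l x0).
have dl : displacement l (fun g => p * ln (f1 (act g x0)) + (1 - p) * ln (f2 (act g x0))).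
  by move=> g x; rewrite /l (displacement_ln pf1 g x) (displacement_ln pf2 g x); ring.
have ph : positive_multiplicative h := displacement_exp dl.
have [h0 h1 qh] := ph.
have l0 : l x0 = 0 by rewrite /l f11 f21 ln1; ring.
have fh : log_coord f = log_coord h.
  by rewrite fE; apply/rowP => i; rewrite !mxE /h l0 subr0 expRK.
(* [D x y] is the convexity gap of [expR] for the logarithmic increments of [f1] and [f2] from [x]
   to [y]. *)
pose D x y := p * expR (ln (f1 y) - ln (f1 x)) + (1 - p) * expR (ln (f2 y) - ln (f2 x))
  - expR (p * (ln (f1 y) - ln (f1 x)) + (1 - p) * (ln (f2 y) - ln (f2 x))).
have D0 x y : 0 <= D x y by rewrite subr_ge0 convex_expR.
have ratio k x y : (forall x, 0 < k x) -> expR (ln (k y) - ln (k x)) = k y / k x.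
  by move=> k0; rewrite expRD expRN !lnK ?posrE.
have lamE k x : eigenfunction (Hop b c k x0) k -> (forall x, 0 < k x) ->
    Hop b c k x0 = degree x - \sum_(y <- neighbors x) b x y * expR (ln (k y) - ln (k x)).
  move=> ek k0; apply: (mulIf (lt0r_neq0 (k0 x))); rewrite -ek HopE mulrBl mulr_suml.
  congr (_ - _); apply: eq_bigr => y _.
  by rewrite ratio// -mulrA divfK// gt_eqF.
have HhE x : Hop b c h x = h x * (mu + \sum_(y <- neighbors x) b x y * D x y).
  have hy y : h y = h x * expR (p * (ln (f1 y) - ln (f1 x)) +
      (1 - p) * (ln (f2 y) - ln (f2 x))).
    by rewrite /h -expRD /l; congr expR; ring.
  rewrite HopE /mu (lamE f1 x)// (lamE f2 x)//.
  under eq_bigr do rewrite hy mulrCA.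
  rewrite -mulr_sumr mulrC -mulrBr; congr (_ * _).
  set S := (X in _ = _ + X).
  have -> : S = p * \sum_(y <- neighbors x) b x y * expR (ln (f1 y) - ln (f1 x)) +
      (1 - p) * \sum_(y <- neighbors x) b x y * expR (ln (f2 y) - ln (f2 x)) -
      \sum_(y <- neighbors x) b x y * expR (p * (ln (f1 y) - ln (f1 x)) +
        (1 - p) * (ln (f2 y) - ln (f2 x))).
    rewrite !mulr_sumr -big_split -sumrB /=; apply: eq_bigr => y _.
    by rewrite /D; ring.
  by ring.
have sh : supersolution mu h.
  move=> x; rewrite HhE mulrC ler_pM2l// lerDl.
  exact: sum_neighbors_ge0.
have [le_mu eq_mu] := supersolution_le mf ph fh sh.
(* Equality would make the geometric mean [h] an eigenfunction for [mu], so the gap would vanish on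
   every edge. But [f1] and [f2] agree at [x0], and on an edge leaving the set where they agree the
   increments differ. *)
split=> // pp f12; rewrite lt_neqAle le_mu andbT; apply/eqP => mulam.
have hf := eq_mu mulam.
have [z fz] : exists z, f1 z <> f2 z.
  by apply/existsNP => all; apply: f12; apply/funext.
have [|u [v [fu fv uv]]] := @connected_cross (fun x => f1 x = f2 x) x0 z _ fz.
  by rewrite f11.
have : Hop b c h u = mu * h u by rewrite hf mulam; case: mf => _ ->.
rewrite HhE mulrC; move/(mulIf (lt0r_neq0 (h0 u))); apply/eqP.
rewrite gt_eqF// ltrDl; apply: (sum_neighbors_gt0 (D0 u) uv).
rewrite subr_gt0 strictly_convex_expR// fu; apply/eqP => /addIr.
by move/(ln_inj (f10 v) (f20 v)).
Qed.

(** * Level sets of the eigenvalue *)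

(** The superlevel set of any one attained eigenvalue is nonempty and compact. *)
Lemma exists_max_eigenvalue : exists2 f0, multiplicative_eigen f0 &
  forall f, multiplicative_eigen f -> Hop b c f x0 <= Hop b c f0 x0.
Proof.
have [f1 [m1 _]] := log_coord_surj 0.
have [|f0] := compact_EVT_max _ (@compact_multiplicative_ge (Hop b c f1 x0))
  (continuous_subspaceT (@Hop_continuous x0)).
  by exists f1; split => //=.
rewrite inE => -[m0 le10] max0; exists f0 => // f mf.
have [le1f|/ltW lef1] := leP (Hop b c f1 x0) (Hop b c f x0).
  by apply: max0; rewrite inE; split.
exact: le_trans le10.
Qed.

Variable f0 : X -> R.
Hypothesis m0 : multiplicative_eigen f0.
Hypothesis max0 : forall f, multiplicative_eigen f ->
  Hop b c f x0 <= Hop b c f0 x0.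

Definition offset (f : X -> R) : 'rV[R]_d := log_coord f - log_coord f0.

(** Euclidean, to match [sphere] and [open_ball]; the norm carried by row vectors is the maximum
    norm. *)
Definition sqnorm (v : 'rV[R]_d) : R := \sum_(i < d) v ord0 i ^+ 2.

Lemma sqnorm_ge0 (v : 'rV[R]_d) : 0 <= sqnorm v.
Proof. by apply: sumr_ge0 => i _; exact: sqr_ge0. Qed.

Lemma sqnormZ a (v : 'rV[R]_d) : sqnorm (a *: v) = a ^+ 2 * sqnorm v.
Proof.
by rewrite /sqnorm mulr_sumr; apply: eq_bigr => i _; rewrite mxE exprMn.
Qed.

Lemma sqnorm_coord (v : 'rV[R]_d) i : v ord0 i ^+ 2 <= sqnorm v.
Proof.
by rewrite /sqnorm (bigD1 i)//= lerDl; apply: sumr_ge0 => j _; exact: sqr_ge0.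
Qed.

Lemma sqnorm_eq0 (v : 'rV[R]_d) : sqnorm v = 0 -> v = 0.
Proof.
move=> v0; apply/rowP => i; rewrite mxE; apply/eqP.
by rewrite -sqrf_eq0 eq_le sqr_ge0 andbT -v0 sqnorm_coord.
Qed.

Lemma offset_inj f h : multiplicative_eigen f -> multiplicative_eigen h ->
  offset f = offset h -> f = h.
Proof. by move=> mf mh /addIr; exact: log_coord_inj. Qed.

Lemma offset0 : offset f0 = 0.
Proof. by rewrite /offset subrr. Qed.

Lemma offset_surj (v : 'rV[R]_d) : exists f, multiplicative_eigen f /\ offset f = v.
Proof.
have [f [mf fv]] := log_coord_surj (v + log_coord f0).
by exists f; split => //; rewrite /offset fv addrK.
Qed.

Lemma offset_concave p f1 f2 f : 0 <= p <= 1 ->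
  multiplicative_eigen f1 -> multiplicative_eigen f2 -> multiplicative_eigen f ->
  offset f = p *: offset f1 + (1 - p) *: offset f2 ->
  p * Hop b c f1 x0 + (1 - p) * Hop b c f2 x0 <= Hop b c f x0 /\
  (0 < p < 1 -> f1 <> f2 ->
     p * Hop b c f1 x0 + (1 - p) * Hop b c f2 x0 < Hop b c f x0).
Proof.
move=> p01 m1 m2 mf fE; apply: eigenvalue_concave => //.
apply/rowP => i; have := congr1 (fun v : 'rV_d => v ord0 i) fE.
rewrite /offset !mxE; lra.
Qed.

(** Strict concavity would give the midpoint of two maximum points a larger eigenvalue. *)
Lemma max_eigenvalue_unique f : multiplicative_eigen f ->
  Hop b c f x0 = Hop b c f0 x0 -> f = f0.
Proof.
move=> mf ff0; apply: contrapT => nf.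
pose p : R := 2^-1.
have half : 0 < p < 1 by rewrite /p; apply/andP; split; lra.
have [h [mh hv]] := offset_surj (p *: offset f + (1 - p) *: offset f0).
have [|_ /(_ half nf)] := offset_concave _ mf m0 mh hv; first by case/andP: half => /ltW -> /ltW ->.
rewrite ff0; have := max0 mh; lra.
Qed.

(** [f] lies between [f0] and [h] on the ray, so concavity compares its eigenvalue with a mean of
    the maximum and that of [h]. *)
Lemma radial_decrease (w : 'rV[R]_d) (r s : R) f h :
  multiplicative_eigen f -> multiplicative_eigen h ->
  offset f = r *: w -> offset h = s *: w -> 0 <= r -> r < s ->
  Hop b c h x0 <= Hop b c f x0 /\
  (Hop b c h x0 < Hop b c f0 x0 -> Hop b c h x0 < Hop b c f x0).
Proof.
move=> mf mh fr hs r0 rs; pose p := r / s.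
have s0 : 0 < s by exact: le_lt_trans rs.
have p0 : 0 <= p by rewrite divr_ge0// ltW.
have p1 : p < 1 by rewrite ltr_pdivrMr// mul1r.
have [||+ _] := @offset_concave p h f0 f _ mh m0 mf.
- by rewrite p0 ltW.
- by rewrite offset0 scaler0 addr0 hs scalerA divfK// gt_eqF.
by have := max0 mh; split=> [|lth]; nra.
Qed.

(** Intersects the eigenvalue along a ray with an affine function: slope 0 serves the level sets,
    slope 1 the superlevel sets. *)
Lemma concave_on_ray (w : 'rV[R]_d) (mu k T : R) : mu < Hop b c f0 x0 -> 0 <= T ->
  (forall f, multiplicative_eigen f -> offset f = T *: w ->
     Hop b c f x0 <= mu + k * T) ->
  exists r f, [/\ 0 < r, multiplicative_eigen f, offset f = r *: w &
    Hop b c f x0 = mu + k * r].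
Proof.
move=> lt_mu T0 fT.
have /choice[E EP] : forall r : R, exists f, multiplicative_eigen f /\ offset f = r *: w.
  by move=> r; exact: offset_surj.
have [||||r r0 /eqP] := @concave_root R (fun r => Hop b c (E r) x0 - mu - k * r) T.
- move=> r s p p01; have [mr er] := EP r; have [ms es] := EP s.
  have [mp ep] := EP (p * r + (1 - p) * s).
  have [] := offset_concave p01 mr ms mp.
    by rewrite er es ep !scalerA scalerDl.
  by lra.
- have [mE eE] := EP 0.
  have -> : E 0 = f0 by apply: offset_inj => //; rewrite eE scale0r offset0.
  by rewrite mulr0 subr0 subr_gt0.
- by [].
- by have [mT eT] := EP T; have := fT _ mT eT; lra.
rewrite subr_eq0 => /eqP Er; have [mE eE] := EP r.
by exists r, (E r); split => //; lra.
Qed.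

(** Harnack between [x0] and each [act (t i) x0] bounds the coordinates. *)
Lemma log_coord_bounded mu : exists M, forall f i, multiplicative_eigen f ->
  mu <= Hop b c f x0 -> `|log_coord f ord0 i| <= M.
Proof.
have /choice[M MP] : forall i, exists M, 0 <= M /\ forall f, multiplicative_eigen f ->
    mu <= Hop b c f x0 -> `|log_coord f ord0 i| <= M.
  move=> i; have [C C0 hC] := harnack mu x0 (act (t i) x0).
  have [D D0 hD] := harnack mu (act (t i) x0) x0.
  exists (`|ln C| + `|ln D|); split=> [|f [[fp f1 qf] ef] mf]; first exact: addr_ge0.
  have sf : supersolution mu f.
    by move=> x; rewrite (ef x) ler_wpM2r// ltW.
  have := hC f fp sf; have := hD f fp sf; rewrite f1 mulr1 mxE => hDf hCf.
  have lC : ln (f (act (t i) x0)) <= ln C by rewrite ler_ln ?posrE.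
  have lD : 0 <= ln D + ln (f (act (t i) x0)).
    by rewrite -lnM ?posrE// ln_ge0.
  rewrite ler_norml; have := ler_norm (ln C); have := ler_norm (ln D).
  have := normr_ge0 (ln C); have := normr_ge0 (ln D); lra.
exists (\sum_i M i) => f i mf le_mu; apply: le_trans ((MP i).2 f mf le_mu) _.
by rewrite (bigD1 i)//= lerDl; apply: sumr_ge0 => j _; exact: (MP j).1.
Qed.

Lemma eigenvalue_on_ray (w : 'rV[R]_d) mu : w != 0 -> mu < Hop b c f0 x0 ->
  exists r f, [/\ 0 < r, multiplicative_eigen f, offset f = r *: w &
    Hop b c f x0 = mu].
Proof.
move=> w0 lt_mu; have [i wi] : exists i, w ord0 i != 0.
  apply: contrapT => /forallNP all; move/eqP: w0; apply; apply/rowP => i; rewrite mxE.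
  by apply/eqP/negPn/negP; exact: all.
have [M MP] := log_coord_bounded mu.
have M0 : 0 <= M by apply: le_trans (MP f0 i m0 (ltW lt_mu)).
(* At parameter [T] the coordinate [i] has moved by [M + |v| + 1], so its absolute value is beyond
   [M] and the eigenvalue is below [mu]. *)
pose v := ln (f0 (act (t i) x0)); pose T := (M + `|v| + 1) / `|w ord0 i|.
have wi0 : 0 < `|w ord0 i| by rewrite normr_gt0.
have T0 : 0 <= T by rewrite divr_ge0// !addr_ge0.
have [|r [f [r0 mf fr fmu]]] := @concave_on_ray w mu 0 T lt_mu T0.
  move=> f mf fT; rewrite mul0r addr0 leNgt; apply/negP => /ltW /(MP f i mf); rewrite mxE.
  have := congr1 (fun v : 'rV_d => v ord0 i) fT; rewrite !mxE -/v => e1.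
  have e2 : `|ln (f (act (t i) x0)) - v| = M + `|v| + 1.
    by rewrite e1 normrM (ger0_norm T0) divfK// gt_eqF.
  by have := ler_normB (ln (f (act (t i) x0))) v; rewrite e2; lra.
by exists r, f; split => //; rewrite fmu mul0r addr0.
Qed.

Lemma log_eval_continuous x (f : {ptws X -> R}) : 0 < f x ->
  {for f, continuous (fun h : {ptws X -> R} => ln (h x))}.
Proof.
move=> fx; apply: (@continuous_comp _ _ _ (fun h : {ptws X -> R} => h x)).
  exact: (@eval_continuous x f).
exact: continuous_ln.
Qed.

Lemma offset_continuous i (f : {ptws X -> R}) : (forall x, 0 < f x) ->
  {for f, continuous (fun h : {ptws X -> R} => offset h ord0 i)}.
Proof.
move=> fp; rewrite (_ : (fun _ => _) =
  fun h : {ptws X -> R} => ln (h (act (t i) x0)) - log_coord f0 ord0 i); last first.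
  by apply/funext => h; rewrite !mxE.
apply: (@cvgB _ _ _ (nbhs f) _ (fun h : {ptws X -> R} => ln (h (act (t i) x0)))).
  exact: log_eval_continuous.
exact: cvg_cst.
Qed.

Lemma sqnorm_offset_continuous (f : {ptws X -> R}) : (forall x, 0 < f x) ->
  {for f, continuous (fun h : {ptws X -> R} => sqnorm (offset h))}.
Proof.
move=> fp; apply: (@continuous_big_sum _ _ _ _
  (fun i (h : {ptws X -> R}) => offset h ord0 i ^+ 2)) => i.
rewrite (_ : (fun _ => _) =
  fun h : {ptws X -> R} => offset h ord0 i * offset h ord0 i); last first.
  by apply/funext => h; rewrite expr2.
apply: (@cvgM _ _ (nbhs f) _ (fun h : {ptws X -> R} => offset h ord0 i)
  (fun h : {ptws X -> R} => offset h ord0 i)); exact: offset_continuous.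
Qed.

Lemma normalized_offset_continuous (k : {ptws X -> R} -> R) (f : {ptws X -> R}) :
  (forall x, 0 < f x) -> {for f, continuous k} -> 0 < k f ->
  {for f, continuous (fun h : {ptws X -> R} => (Num.sqrt (k h))^-1 *: offset h)}.
Proof.
move=> fp kc k0; apply: continuous_rV => i.
rewrite (_ : (fun _ => _) =
  fun h : {ptws X -> R} => (Num.sqrt (k h))^-1 * offset h ord0 i); last first.
  by apply/funext => h; rewrite !mxE.
apply: (@cvgM _ _ (nbhs f) _ (fun h : {ptws X -> R} => (Num.sqrt (k h))^-1)
  (fun h : {ptws X -> R} => offset h ord0 i)); last exact: offset_continuous.
apply: (@cvgV _ _ (nbhs f) _ (fun h : {ptws X -> R} => Num.sqrt (k h))).
  by rewrite gt_eqF// sqrtr_gt0.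
apply: (@continuous_comp _ _ _ k); first exact: kc.
exact: sqrt_continuous.
Qed.

(** Radial projection from the maximum point: every ray meets the level set by [eigenvalue_on_ray],
    and only once by the strict part of [radial_decrease]. *)
Lemma level_set_sphere mu : mu < Hop b c f0 x0 ->
  homeomorphic (multiplicative_eigen `&` [set f | Hop b c f x0 = mu]
    : set {ptws X -> R}) (@sphere R d).
Proof.
move=> lt_mu; set A := _ `&` _.
pose h (f : {ptws X -> R}) := (Num.sqrt (sqnorm (offset f)))^-1 *: offset f.
have pos f : A f -> 0 < sqnorm (offset f).
  move=> [mf fmu]; rewrite lt_neqAle sqnorm_ge0 andbT eq_sym; apply/eqP => /sqnorm_eq0 e0.
  have ff0 : f = f0 by apply: offset_inj => //; rewrite e0 offset0.
  by move: lt_mu; rewrite -fmu ff0 ltxx.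
have cA : compact A.
  rewrite (_ : A = multiplicative_eigen `&` [set f | mu <= Hop b c f x0] `&`
      [set f | Hop b c f x0 = mu]).
    apply: compact_closedI; first exact: compact_multiplicative_ge.
    apply: (@closed_eq_fun _ _ (fun f : {ptws X -> R} => Hop b c f x0) (fun=> mu)).
      exact: Hop_continuous.
    exact: cst_continuous.
  apply/seteqP; split=> f [] => [mf fmu|[mf _] fmu]; last by split.
  by split => //; split => //=; rewrite (fmu : Hop b c f x0 = mu).
apply: (@homeomorphic_locally_compact _ _ A _ h f0).
- exact: rV_hausdorff.
- move=> f Af; rewrite /sphere /= -/(sqnorm _) sqnormZ exprVn sqr_sqrtr ?sqnorm_ge0//.
  by rewrite mulVf// gt_eqF// pos.
- move=> v v1; have {}v1 : sqnorm v = 1 by [].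
  have v0 : v != 0.
    apply: contra_eq_neq v1 => ->; rewrite /sqnorm big1 ?(eq_sym 0) ?oner_neq0// => i _.
    by rewrite mxE expr0n.
  have [r [f [r0 mf fr fmu]]] := eigenvalue_on_ray v0 lt_mu.
  exists f; first by split.
  rewrite /h fr sqnormZ v1 mulr1 sqrtr_sqr ger0_norm ?ltW// scalerA mulVf ?scale1r//.
  by rewrite gt_eqF.
- move=> f f' Af Af' hff'; have := pos _ Af; have := pos _ Af'.
  rewrite -sqrtr_gt0 => s'0; rewrite -sqrtr_gt0 => s0.
  have fE : offset f = Num.sqrt (sqnorm (offset f)) *: h f.
    by rewrite /h scalerA mulfV ?scale1r// gt_eqF.
  have f'E : offset f' = Num.sqrt (sqnorm (offset f')) *: h f.
    by rewrite hff' /h scalerA mulfV ?scale1r// gt_eqF.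
  have [mf fmu] := Af; have [mf' fmu'] := Af'.
  have [lt_s|lt_s|eq_s] := ltgtP (Num.sqrt (sqnorm (offset f)))
    (Num.sqrt (sqnorm (offset f'))).
  + have [_] := radial_decrease mf mf' fE f'E (ltW s0) lt_s.
    by rewrite fmu fmu' ltxx => /(_ lt_mu).
  + have [_] := radial_decrease mf' mf f'E fE (ltW s'0) lt_s.
    by rewrite fmu fmu' ltxx => /(_ lt_mu).
  + by apply: offset_inj => //; rewrite fE f'E eq_s.
- move=> v _; exists A, setT; split.
  + exact: filterT.
  + exact: cA.
  + by move=> f [].
  + move=> f Af; have [[[fp _ _] _] _] := Af.
    apply: (@normalized_offset_continuous (fun h => sqnorm (offset h)) f fp).
      exact: sqnorm_offset_continuous.
    exact: pos.
  + by move=> f Af _.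
Qed.

Lemma sqnorm_continuous : continuous (sqnorm : 'rV[R]_d -> R).
Proof.
move=> v; apply: (@continuous_big_sum _ _ _ _ (fun i (w : 'rV[R]_d) => w ord0 i ^+ 2)).
move=> i; apply: (@cvgM _ _ (nbhs v) _ (fun w : 'rV[R]_d => w ord0 i)
  (fun w : 'rV[R]_d => w ord0 i)); exact: coord_continuous.
Qed.

(* On [A] the map [offset / k] is a bijection onto R^d, and [w / sqrt (1 + |w|^2)]
   maps R^d onto the open ball; written as below, the composite also makes sense
   where [k] vanishes. *)
Lemma homeomorphic_open_ball (A : set {ptws X -> R}) (k : {ptws X -> R} -> R) :
  A `<=` multiplicative_eigen -> continuous k -> (forall f, A f -> 0 < k f) ->
  (forall w, exists2 f, A f & offset f = k f *: w) ->
  (forall w f f', A f -> A f' -> offset f = k f *: w -> offset f' = k f' *: w ->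
     f = f') ->
  (forall rho, exists K : set {ptws X -> R}, [/\ compact K,
     forall f, A f -> sqnorm (offset f) <= rho * k f ^+ 2 -> K f,
     K `<=` multiplicative_eigen,
     forall f, K f -> 0 <= k f /\ (0 < k f -> A f) &
     forall f, K f -> k f = 0 -> offset f != 0]) ->
  homeomorphic A (@open_ball R d).
Proof.
move=> Am kc k0 ksurj kinj kK.
pose q f := k f ^+ 2 + sqnorm (offset f).
pose h (f : {ptws X -> R}) := (Num.sqrt (q f))^-1 *: offset f.
have q_ge0 f : 0 <= q f by rewrite addr_ge0 ?sqr_ge0 ?sqnorm_ge0.
have sqh f : 0 < q f -> sqnorm (h f) * q f = sqnorm (offset f).
  move=> q0; rewrite sqnormZ exprVn sqr_sqrtr// mulrAC mulVf ?mul1r// gt_eqF//.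
have qA f : A f -> 0 < q f.
  by move=> Af; rewrite ltr_pwDl ?sqnorm_ge0// exprn_gt0// k0.
have hA f : A f -> sqnorm (h f) < 1.
  move=> Af; have := sqh _ (qA _ Af); have := qA _ Af.
  have : 0 < k f ^+ 2 by rewrite exprn_gt0// k0.
  by rewrite /q; nra.
have sq1 (v : 'rV[R]_d) : sqnorm v < 1 -> 0 < Num.sqrt (1 - sqnorm v).
  by move=> v1; rewrite sqrtr_gt0 subr_gt0.
have hE f : A f -> Num.sqrt (q f) * Num.sqrt (1 - sqnorm (h f)) = k f.
  move=> Af; have q0 := qA _ Af.
  rewrite -sqrtrM// (_ : q f * (1 - sqnorm (h f)) = k f ^+ 2); last first.
    by have := sqh _ q0; rewrite /q; lra.
  by rewrite sqrtr_sqr ger0_norm// ltW// k0.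
apply: (@homeomorphic_locally_compact _ _ A _ h f0).
- exact: rV_hausdorff.
- by move=> f /hA.
- move=> v v1; have := sq1 v v1; set z := Num.sqrt _ => z0.
  (* Inverse of [w / sqrt (1 + |w|^2)] at [v]. *)
  have [f Af fv] := ksurj (z^-1 *: v); exists f => //.
  have kf := k0 _ Af.
  have z2 : z ^+ 2 = 1 - sqnorm v by rewrite sqr_sqrtr// subr_ge0 ltW.
  have qE : q f = (k f / z) ^+ 2.
    rewrite /q fv !sqnormZ exprMn !exprVn.
    have -> : sqnorm v = 1 - z ^+ 2 by lra.
    by field; rewrite gt_eqF.
  rewrite /h qE sqrtr_sqr ger0_norm; last by rewrite divr_ge0// ltW.
  rewrite fv !scalerA (_ : _ * _ * _ = 1) ?scale1r//.
  by field; rewrite !gt_eqF.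
- move=> f f' Af Af' hff'.
  have offE g : A g -> offset g = k g *: ((Num.sqrt (1 - sqnorm (h g)))^-1 *: h g).
    move=> Ag; rewrite -[in k g](hE _ Ag) scalerA mulfK; last first.
      by rewrite gt_eqF// sq1// hA.
    by rewrite /h scalerA mulfV ?scale1r// gt_eqF// sqrtr_gt0 qA.
  apply: kinj => //; first exact: offE.
  by rewrite hff'; exact: offE.
- move=> v v1; have {}v1 : sqnorm v < 1 by [].
  (* Any [s] strictly between [sqnorm v] and 1 works: [sqnorm (h f) < s] bounds [sqnorm (offset f)]
     by [s / (1 - s) * k f ^+ 2]. *)
  pose s := (1 + sqnorm v) / 2.
  have vs : sqnorm v < s by rewrite /s; lra.
  have s1 : s < 1 by rewrite /s; lra.
  have [K [cK AK Km Kk K0]] := kK (s / (1 - s)).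
  have qK f : K f -> 0 < q f.
    move=> Kf; rewrite lt_neqAle q_ge0 andbT eq_sym; apply/eqP => q0.
    have := sqnorm_ge0 (offset f); have := sqr_ge0 (k f); move: q0; rewrite /q => q0 k2 u2.
    have /eqP : k f ^+ 2 = 0 by lra.
    rewrite sqrf_eq0 => /eqP /(K0 _ Kf) /eqP; apply; apply: sqnorm_eq0; lra.
  exists K, [set w | sqnorm w < s]; split.
  + exact: (cvgr_lt _ (@sqnorm_continuous v)).
  + exact: cK.
  + move=> f [Af hs]; apply: AK => //.
    have := sqh _ (qA _ Af); have {}hs : sqnorm (h f) < s by [].
    rewrite mulrAC ler_pdivlMr ?subr_gt0//; move=> e1.
    by have := qA _ Af; move: e1; rewrite /q; nra.
  + move=> f Kf; have [[fp _ _] _] := Km _ Kf.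
    apply: (normalized_offset_continuous fp _ (qK _ Kf)).
    apply: (@cvgD _ _ _ (nbhs f) _ (fun f : {ptws X -> R} => k f ^+ 2)
      (fun f : {ptws X -> R} => sqnorm (offset f))).
      by apply: (@cvgM _ _ (nbhs f) _ k k); exact: kc.
    exact: sqnorm_offset_continuous.
  + move=> f Kf hv; have [kge kA] := Kk _ Kf; apply: kA.
    (* A point of [K] with [k f = 0] is mapped to the unit sphere, hence not to [v]. *)
    rewrite lt_neqAle kge andbT eq_sym; apply/eqP => kf0.
    have := sqh _ (qK _ Kf); rewrite hv; have := qK _ Kf; rewrite /q kf0 expr0n /= add0r.
    by nra.
Qed.

(** Here [k] is the height above the level [l]; the closed superlevel set serves as [K], and [k]
    vanishes on its boundary level. *)
Lemma superlevel_set_ball (l : R) : l < Hop b c f0 x0 ->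
  homeomorphic (multiplicative_eigen `&` [set f | l < Hop b c f x0]
    : set {ptws X -> R}) (@open_ball R d).
Proof.
move=> lt_l; apply: (homeomorphic_open_ball (k := fun f => Hop b c f x0 - l)).
- by move=> f [].
- move=> f; apply: (@cvgB _ _ _ (nbhs f) _ (fun f : {ptws X -> R} => Hop b c f x0)).
    exact: (@Hop_continuous x0 f).
  exact: cvg_cst.
- by move=> f [_ /=]; rewrite subr_gt0.
(* The required [f] lies at a parameter [r] with eigenvalue [l + r]; at [T], the height of the
   maximum, the line has already reached the maximal eigenvalue. *)
- move=> w; have [||r [f [r0 mf fr fl]]] :=
    @concave_on_ray w l 1 (Hop b c f0 x0 - l) lt_l.
  + by rewrite subr_ge0 ltW.
  + by move=> f mf _; have := max0 mf; lra.
  exists f; first by split => //=; lra.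
  by rewrite fr; congr (_ *: _); lra.
(* A larger height [k] means a point farther out on the ray, where the eigenvalue cannot be
   larger. *)
- move=> w f f' [mf /= lf] [mf' /= lf'] fw f'w.
  wlog le_ff' : f f' mf mf' lf lf' fw f'w / Hop b c f x0 <= Hop b c f' x0.
    by move=> wl; have [/wl|/ltW /wl] := leP (Hop b c f x0) (Hop b c f' x0);
      [exact|move=> /(_ mf' mf lf' lf f'w fw)].
  have [e_ff'|lt_ff'] := eqVneq (Hop b c f x0) (Hop b c f' x0).
    by apply: offset_inj => //; rewrite fw f'w e_ff'.
  have {}lt_ff' : Hop b c f x0 - l < Hop b c f' x0 - l.
    by rewrite ltrD2r lt_neqAle lt_ff'.
  have [|le_f'f _] := radial_decrease mf mf' fw f'w _ lt_ff'; first lra.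
  by exfalso; move: le_f'f lt_ff'; lra.
- move=> rho; exists (multiplicative_eigen `&` [set f | l <= Hop b c f x0]).
  split.
  + exact: compact_multiplicative_ge.
  + by move=> f [mf /= /ltW].
  + by move=> f [].
  + by move=> f [mf /= lf]; rewrite subr_ge0 subr_gt0.
  + move=> f [mf _] /eqP; rewrite subr_eq0 => /eqP fl; apply/eqP => f00.
    have ff0 : f = f0 by apply: offset_inj => //; rewrite f00 offset0.
    by move: lt_l; rewrite -fl ff0 ltxx.
Qed.

(** With [k = 1] the bijection onto R^d is [offset] itself; compactness comes from the lower bound
    on the eigenvalue over bounded coordinates. *)
Lemma multiplicative_eigen_ball :
  homeomorphic (multiplicative_eigen : set {ptws X -> R}) (@open_ball R d).
Proof.
apply: (homeomorphic_open_ball (k := fun=> 1)).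
- by [].
- exact: cst_continuous.
- by [].
- by move=> w; have [f [mf fw]] := offset_surj w; exists f; rewrite ?scale1r.
- move=> w f f' mf mf'; rewrite scale1r => fw f'w.
  by apply: offset_inj => //; rewrite fw f'w.
(* [rho + 1] bounds each coordinate of the offset, since [t <= t^2 + 1]; the sum accounts for the
   coordinates of [f0]. *)
- move=> rho; pose M := \sum_i `|log_coord f0 ord0 i| + (rho + 1).
  have [mu muP] := eigenvalue_lower_bound M.
  exists (multiplicative_eigen `&` [set f | mu <= Hop b c f x0]); split.
  + exact: compact_multiplicative_ge.
  + move=> f mf; rewrite expr1n mulr1 => frho; split => //=; apply: muP => // i.
    set x := log_coord f ord0 i; pose y := log_coord f0 ord0 i.
    have := le_trans (sqnorm_coord (offset f) i) frho.
    have -> : offset f ord0 i = x - y by rewrite /x /y /offset !mxE.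
    rewrite expr2 => xy.
    have : `|y| <= \sum_i `|log_coord f0 ord0 i|.
      by rewrite (bigD1 i)//= lerDl; apply: sumr_ge0.
    have : `|x - y| <= rho + 1.
      have n2 : `|x - y| * `|x - y| = (x - y) * (x - y).
        by rewrite -normrM ger0_norm// -expr2 sqr_ge0.
      by have := sqr_ge0 (`|x - y| - 1); rewrite expr2; move: n2 xy; nra.
    have : `|x| <= `|x - y| + `|y| by have := ler_normD (x - y) y; rewrite subrK.
    by rewrite /M; lra.
  + by move=> f [].
  + by move=> f [].
  + by move=> f _ /eqP; rewrite oner_eq0.
Qed.

End Coordinates.
End GroupAction.
End Operator.

(** * Transfer to the sets [Mset] and [MsetI] *)

Theorem theorem3 (R : realType) (X : countType) (b : X -> X -> R) (c : X -> R)
  (G : groupType) (act : G -> X -> X) (x0 : X) :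
  (forall x y, 0 <= b x y) ->
  locally_finite b ->
  connected_graph b ->
  is_action act ->
  cocompact act ->
  nilpotent_group G ->
  G_invariant act b c ->
  exists (lam0 : R) (d : nat),
    [/\ (forall lam : R, lam0 < lam -> Mset act b c x0 lam = set0),
        (exists f : {ptws X -> R}, Mset act b c x0 lam0 = [set f]),
        (forall lam : R, lam < lam0 -> homeomorphic (Mset act b c x0 lam) (@sphere R d)) &
        (forall l : \bar R, (l < lam0%:E)%E ->
           homeomorphic (MsetI act b c x0 [set mu : R | (l < mu%:E)%E /\ mu <= lam0])
                        (@open_ball R d))].
Proof.
move=> b0 lfb connb actP cocom _ invb.
have [S sepS] := characters_separated b0 lfb connb x0 actP cocom invb.
have charZ k (a : G -> R) : characters act a -> characters act (fun g => k * a g).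
  by move=> [l dl]; exists (fun x => k * l x) => g x; rewrite dl mulrDr.
have [d [t [e [ec et sept]]]] := exists_dual_basis charZ sepS.
have /choice[L eL] := ec.
have [f0 m0 max0] := exists_max_eigenvalue b0 lfb connb x0 cocom invb eL et.
have ME mu : Mset act b c x0 mu =
    multiplicative_eigen b c act x0 `&` [set f : {ptws X -> R} | Hop b c f x0 = mu].
  by apply/seteqP; split=> f; [move/(MsetE c b0 lfb connb x0 actP)|
    move=> mf; apply/(MsetE c b0 lfb connb x0 actP)].
exists (Hop b c f0 x0), d; split.
- move=> mu lt_mu; rewrite ME; apply/seteqP; split=> f // -[mf /= fmu].
  by have := max0 f mf; rewrite fmu leNgt lt_mu.
- exists f0; rewrite ME; apply/seteqP; split=> f /=; last by move=> ->.
  by move=> [mf]; exact: (max_eigenvalue_unique b0 lfb connb cocom invb eL et sept m0 max0).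
- move=> mu lt_mu; rewrite ME.
  exact: (level_set_sphere b0 lfb connb cocom invb eL et sept m0 max0).
(* The upper bound on [mu] holds automatically by maximality of the eigenvalue of [f0]. *)
- have MI l : MsetI act b c x0 [set mu | (l < mu%:E)%E /\ mu <= Hop b c f0 x0] =
      multiplicative_eigen b c act x0 `&` [set f : {ptws X -> R} |
        (l < (Hop b c f x0)%:E)%E].
    apply/seteqP; split=> f.
      by move=> [mu [lmu _]]; rewrite ME => -[mf /= ->].
    move=> [mf lf]; exists (Hop b c f x0); last by rewrite ME.
    by split; [exact: lf|exact: max0].
  (* The cases are a real [l], [+oo], which contradicts [lt_l], and [-oo], where the set is all of
     [multiplicative_eigen]. *)
  case=> [l||] lt_l; rewrite MI.
  + rewrite (_ : [set f | _] = [set f : {ptws X -> R} | l < Hop b c f x0]); last first.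
      by apply/seteqP; split=> f /=; rewrite lte_fin.
    exact: (superlevel_set_ball b0 lfb connb cocom invb eL et sept m0 max0).
  + by [].
  + rewrite (_ : [set f : {ptws X -> R} | (-oo < (Hop b c f x0)%:E)%E] = setT);
      last by apply/seteqP; split=> f //= _; rewrite ltNyr.
    rewrite setIT.
    exact: (multiplicative_eigen_ball b0 lfb connb x0 cocom invb eL et sept f0).
Qed.
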